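(* Let $\Gamma$ and $\Delta$ be finite or countable $\omega$-categorical relational structures with finite signatures. If $\mathrm{Pol}(\Gamma)$ and $\mathrm{Pol}(\Delta)$ are isomorphic as topological clones, then $\mathrm{CSP}(\Gamma)$ and $\mathrm{CSP}(\Delta)$ are polynomial-time equivalent.
   Context: A countable structure is $\omega$-categorical iff all countable models of its first-order theory are isomorphic to it. For a structure $\Gamma$ with finite relational signature $\tau$, $\mathrm{CSP}(\Gamma)$ is the computational problem of deciding whether a given primitive positive $\tau$-sentence (a sentence $\exists x_1,\dots,x_n(\phi_1\wedge\dots\wedge\phi_m)$ with all $\phi_i$ atomic $\tau$-formulas) is true in $\Gamma$. Two problems are polynomial-time equivalent iff each has a polynomial-time reduction to the other. A polymorphism of $\Gamma$ is a homomorphism from $\Gamma^k$ to $\Gamma$ for some finite $k\ge1$; $\mathrm{Pol}(\Gamma)$ is the set of all polymorphisms. For a set $D$, let $\mathcal O_D=\bigcup_{k\ge1}D^{D^k}$, topologized as the sum space of the spaces $D^{D^k}$, where $D$ is discrete and $D^{D^k}$ has the product topology; $\mathrm{Pol}(\Gamma)$ carries the subspace topology. A clone is a set of finitary functions on a fixed set that contains all projections and is closed under composition. A clone homomorphism is a function (preserving arities) between clones that sends every projection to the corresponding projection and satisfies $\xi(f(g_1,\dots,g_n))=\xi(f)(\xi(g_1),\dots,\xi(g_n))$ for all $n$-ary $f$ and $m$-ary $g_1,\dots,g_n$. Two clones are isomorphic as topological clones iff there is a bijection $\xi$ between them such that $\xi$ and $\xi^{-1}$ are continuous clone homomorphisms.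 *)

(* Defs.v *)
From HB Require Import structures.
From mathcomp Require Import all_boot.
From mathcomp Require Import all_classical topology.

Set Implicit Arguments.
Unset Strict Implicit.
Unset Printing Implicit Defensive.

Local Open Scope classical_set_scope.

Record signature := Signature {
  symbol : finType;
  arity : symbol -> nat
}.

Record structure (tau : signature) := Structure {
  domain :> choiceType;
  interp : forall R : symbol tau, set ((arity R).-tuple domain)
}.

(* Formulas are well scoped: the free variables of [f : formula tau n] are
   indexed by 'I_n, and the most recently bound variable has index 0. Falsity
   and equality are atomic formulas of every signature. *)
Inductive atom (tau : signature) (n : nat) : Type :=
| ABot
| AEq of 'I_n & 'I_n
| ARel (R : symbol tau) of (arity R).-tuple 'I_n.

Inductive formula (tau : signature) : nat -> Type :=
| FAtom n of atom tau n : formula tau n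
| FImp n of formula tau n & formula tau n : formula tau n
| FAll n of formula tau n.+1 : formula tau n.

Section Semantics.
Variables (tau : signature) (A : structure tau).

Definition sat_atom n (e : n.-tuple A) (a : atom tau n) : Prop :=
  match a with
  | ABot => False
  | AEq x y => tnth e x = tnth e y
  | ARel R t => interp (map_tuple (tnth e) t)
  end.

Fixpoint sat n (f : formula tau n) : n.-tuple A -> Prop :=
  match f with
  | FAtom _ a => fun e => sat_atom e a
  | FImp _ g h => fun e => sat g e -> sat h e
  | FAll _ g => fun e => forall d : A, sat g (cons_tuple d e)
  end.

Definition theory : set (formula tau 0) := [set f | sat f [tuple]].

Definition model_of (T : set (formula tau 0)) : Prop := T `<=` theory.

End Semantics.

Definition structure_isomorphic tau (A B : structure tau) : Prop :=
  exists2 h : A -> B, bijective h &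
    forall (R : symbol tau) (t : (arity R).-tuple A),
      interp t <-> interp (map_tuple h t).

(* [countable] means at most countable. *)
Definition omega_categorical tau (A : structure tau) : Prop :=
  countable [set: A] /\
  forall B : structure tau, countable [set: B] -> model_of B (theory A) ->
    structure_isomorphic B A.

Definition power tau (A : structure tau) (k : nat) : structure tau :=
  @Structure tau (k.-tuple A) (fun R =>
    [set t | forall j : 'I_k, interp (map_tuple (fun x => tnth x j) t)]).

Definition homomorphism tau (A B : structure tau) (h : A -> B) : Prop :=
  forall (R : symbol tau) (t : (arity R).-tuple A),
    interp t -> interp (map_tuple h t).

(* The arity of [f : operation D k] is k + 1, so that nullary operations are
   excluded. *)
Definition operation (D : choiceType) (k : nat) : topologicalType :=
  {ptws k.+1.-tuple D -> discrete_topology D}.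

(* All finitary operations on D, with the sum topology. *)
Definition operations (D : choiceType) : topologicalType :=
  {k : nat & operation D k}.

Definition proj_op (D : choiceType) k (i : 'I_k.+1) : operation D k :=
  fun t => tnth t i.

Definition comp_op (D : choiceType) n m (f : operation D n)
    (g : 'I_n.+1 -> operation D m) : operation D m :=
  fun t => f [tuple g i t | i < n.+1].

Record clone (D : choiceType) := Clone {
  clone_ops :> forall k, set (operation D k);
  clone_proj : forall k (i : 'I_k.+1), clone_ops (proj_op i);
  clone_comp : forall n m (f : operation D n) (g : 'I_n.+1 -> operation D m),
    clone_ops f -> (forall i, clone_ops (g i)) -> clone_ops (comp_op f g)
}.

Lemma Pol_proj tau (A : structure tau) k (i : 'I_k.+1) :
  homomorphism (proj_op i : power A k.+1 -> A).
Proof. by move=> R t; apply. Qed.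

Lemma Pol_comp tau (A : structure tau) n m (f : operation A n)
    (g : 'I_n.+1 -> operation A m) :
  homomorphism (f : power A n.+1 -> A) ->
  (forall i, homomorphism (g i : power A m.+1 -> A)) ->
  homomorphism (comp_op f g : power A m.+1 -> A).
Proof.
move=> hf hg R t Rt.
pose h (x : m.+1.-tuple A) := [tuple g i x | i < n.+1].
have -> : map_tuple (comp_op f g) t = map_tuple f (map_tuple h t).
  by apply: eq_from_tnth => i; rewrite !tnth_map.
apply: hf => j; suff -> : map_tuple (fun x => tnth x j) (map_tuple h t) =
  map_tuple (g j) t by exact: hg.
by apply: eq_from_tnth => i; rewrite !tnth_map tnth_ord_tuple.
Qed.

Definition Pol tau (A : structure tau) : clone A :=
  @Clone A (fun k => [set f | homomorphism (f : power A k.+1 -> A)])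
    (@Pol_proj tau A) (@Pol_comp tau A).

Section CloneHomomorphisms.
Variables D E : choiceType.

Definition clone_proj_elt (C : clone D) k (i : 'I_k.+1) : C k :=
  exist _ (proj_op i) (mem_set (clone_proj C i)).

Definition clone_comp_elt (C : clone D) n m (f : C n) (g : 'I_n.+1 -> C m) :
    C m :=
  exist _ (comp_op (set_val f) (fun i => set_val (g i)))
    (mem_set (clone_comp (set_valP f) (fun i => set_valP (g i)))).

(* The set of operations of all arities in the clone; as a type it carries the
   subspace topology of the sum space [operations D]. *)
Definition clone_set (C : clone D) : set (operations D) :=
  [set f | C (projT1 f) (projT2 f)].

End CloneHomomorphisms.

Definition clone_homomorphism (D E : choiceType) (C : clone D) (C' : clone E)
    (xi : forall k, C k -> C' k) : Prop :=
  (forall k (i : 'I_k.+1),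
     xi k (clone_proj_elt C i) = clone_proj_elt C' i) /\
  (forall n m (f : C n) (g : 'I_n.+1 -> C m),
     xi m (clone_comp_elt f g) =
     clone_comp_elt (xi n f) (fun i => xi m (g i))).

Definition clone_map (D E : choiceType) (C : clone D) (C' : clone E)
    (xi : forall k, C k -> C' k) (f : clone_set C) : clone_set C' :=
  let k := projT1 (set_val f) in
  let g := xi k (exist _ (projT2 (set_val f)) (mem_set (set_valP f))) in
  exist _ (existT _ k (set_val g)) (mem_set (set_valP g)).

Definition topological_clone_isomorphic (D E : choiceType)
    (C : clone D) (C' : clone E) : Prop :=
  exists (xi : forall k, C k -> C' k) (xi' : forall k, C' k -> C k),
    [/\ forall k, cancel (xi k) (xi' k), forall k, cancel (xi' k) (xi k),
        clone_homomorphism xi /\ clone_homomorphism xi',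
        continuous (clone_map xi) & continuous (clone_map xi')].

(* A decision problem with a word encoding of its instances. *)
Record problem := Problem {
  instance : Type;
  alphabet : finType;
  encode : instance -> seq alphabet;
  answer : instance -> Prop
}.

(* Deterministic Turing machines with [tapes.+1] two-way infinite tapes. A cell
   holds [Some a], or [None] if it is blank. *)
Inductive direction := MoveLeft | Stay | MoveRight.

Record machine (I O : finType) := Machine {
  state : finType;
  letter : finType;
  tapes : nat;
  in_letter : I -> letter;
  out_letter : O -> letter;
  in_letter_inj : injective in_letter;
  out_letter_inj : injective out_letter;
  start : state;
  halting : pred state;
  transition : state -> tapes.+1.-tuple (option letter) ->
    state * tapes.+1.-tuple (option letter * direction)
}.

(* The cells strictly left of the head, nearest first, and the cells from the
   head on; all other cells are blank. *)
Record tape (L : Type) := Tape {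
  left_cells : seq (option L);
  right_cells : seq (option L)
}.

Definition read L (t : tape L) : option L := head None (right_cells t).

Definition write_move L (t : tape L) (a : option L * direction) : tape L :=
  let l := left_cells t in
  let r := a.1 :: behead (right_cells t) in
  match a.2 with
  | MoveLeft => Tape (behead l) (head None l :: r)
  | Stay => Tape l r
  | MoveRight => Tape (a.1 :: l) (behead r)
  end.

Section Runs.
Variables (I O : finType) (M : machine I O).

Definition configuration : Type :=
  state M * (tapes M).+1.-tuple (tape (letter M)).

Definition step (c : configuration) : configuration :=
  if halting c.1 then c else
  let qa := transition c.1 (map_tuple (@read _) c.2) in
  (qa.1, [tuple write_move (tnth c.2 i) (tnth qa.2 i) | i < (tapes M).+1]).

(* The input is on the first tape, the output is read on the last one, from
   the head on. *)
Definition initial (w : seq I) : configuration :=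
  (start M, [tuple Tape [::]
     (if i == ord0 then [seq Some (in_letter M a) | a <- w] else [::])
     | i < (tapes M).+1]).

Definition has_output (c : configuration) (v : seq O) : Prop :=
  exists b, right_cells (tnth c.2 ord_max) =
    [seq Some (out_letter M a) | a <- v] ++ nseq b None.

Definition computes_within (n : nat) (w : seq I) (v : seq O) : Prop :=
  let c := iter n step (initial w) in halting c.1 /\ has_output c v.

End Runs.

Definition polytime_computable (P Q : problem)
    (f : instance P -> instance Q) : Prop :=
  exists (M : machine (alphabet P) (alphabet Q)) (c d : nat),
    forall x : instance P,
      computes_within M (c * size (encode x) ^ d + c)%N (encode x) (encode (f x)).

Definition polytime_reducible (P Q : problem) : Prop :=
  exists2 f : instance P -> instance Q,
    polytime_computable f & forall x, answer x <-> answer (f x).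

Definition polytime_equivalent (P Q : problem) : Prop :=
  polytime_reducible P Q /\ polytime_reducible Q P.

(* The sentence that existentially quantifies [nvars] variables in front of the
   conjunction of [conjuncts]. *)
Record pp_sentence (tau : signature) := PPSentence {
  nvars : nat;
  conjuncts : seq (atom tau nvars)
}.

Definition pp_true tau (A : structure tau) (s : pp_sentence tau) : Prop :=
  exists e : (nvars s).-tuple A,
    foldr (fun a P => sat_atom e a /\ P) True (conjuncts s).

Inductive mark := Exists | Bottom | Equal | Stroke | EndVar.

Definition mark_to_ord (x : mark) : 'I_5 :=
  inord match x with
  | Exists => 0 | Bottom => 1 | Equal => 2 | Stroke => 3 | EndVar => 4
  end.

Definition ord_to_mark (i : 'I_5) : mark :=
  nth Exists [:: Exists; Bottom; Equal; Stroke; EndVar] i.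

Lemma mark_to_ordK : cancel mark_to_ord ord_to_mark.
Proof. by case; rewrite /ord_to_mark /mark_to_ord inordK. Qed.

HB.instance Definition _ := Finite.copy mark (can_type mark_to_ordK).

(* A sentence is written with one quantifier mark for each variable, followed
   by its conjuncts in prefix notation. Variable names are unary: since every
   variable is quantified explicitly, this changes the length of a sentence by
   at most a polynomial factor in comparison with binary names. *)
Section Encoding.
Variable tau : signature.

Definition word := seq (symbol tau + mark)%type.

Definition encode_var n (x : 'I_n) : word :=
  rcons (nseq x (inr Stroke)) (inr EndVar).

Definition encode_atom n (a : atom tau n) : word :=
  match a with
  | ABot => [:: inr Bottom]
  | AEq x y => inr Equal :: encode_var x ++ encode_var y
  | ARel R t => inl R :: flatten [seq encode_var x | x <- t]
  end.

Definition encode_sentence (s : pp_sentence tau) : word :=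
  nseq (nvars s) (inr Exists) ++
  flatten [seq encode_atom a | a <- conjuncts s].

End Encoding.

Definition CSP tau (A : structure tau) : problem :=
  @Problem (pp_sentence tau) (symbol tau + mark)%type
    (@encode_sentence tau) (@pp_true tau A).

(* Main.v *)
From Stdlib Require Import Eqdep_dec PeanoNat.
Require Import Defs.
From mathcomp Require Import all_boot.
From mathcomp Require Import all_classical topology.
From mathcomp Require Import zify.

Set Implicit Arguments.
Unset Strict Implicit.
Unset Printing Implicit Defensive.

Local Open Scope classical_set_scope.

(** Let [G] and [D] be the two structures and let [xi] be an isomorphism from
    the clone of [D] onto that of [G]. The problem of [G] reduces to that of [D]
    because [G] has a primitive positive interpretation in [D]: elements of [G]
    are represented by tuples of elements of [D] in such a way that
    conjunctive conditions on elements translate into conjunctive conditions on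
    tuples. Exchanging the roles of the two structures gives the other
    reduction.

    What omega-categoricity contributes is that the automorphism group is
    oligomorphic: it has finitely many orbits on [n]-tuples, for every [n]
    ([omega_categorical_oligomorphic], the theorem of Ryll-Nardzewski). Finite
    structures have this property trivially. Oligomorphicity is a compactness
    principle ([compactness]): a sequence of functions from a countable set to
    [D] has, after composition of its members with automorphisms, an
    accumulation point in the topology of pointwise convergence. The principle
    is used twice.

    First, a relation that is preserved by all polymorphisms of an oligomorphic
    structure is primitive positive definable ([invariant_pp_definable]). Such a
    relation is generated by finitely many tuples, which form one point
    [c j] of a finite power of the structure for each coordinate [j]; it
    consists of the images of these points under polymorphisms, and by
    compactness it is enough to consider homomorphisms from a finite part of
    the power, whose existence is a primitive positive condition.

    Second, the isomorphism is uniformly continuous at any tuple [b]: there is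
    a finite set [F] such that the value of [xi f] at [b] depends only on the
    restriction of [f] to [F] ([xi_graph_uniform]). Since [G] is oligomorphic,
    some finite tuple [b] generates [G] under its polymorphisms. So
    [f|F |-> xi f b] is a well defined map from a set of tuples of elements
    of [D] onto [G]. As [xi] is a clone homomorphism, the domain of this map
    and the preimages of the relations of [G], equality included, are
    preserved by the polymorphisms of [D]; by the first point they are primitive
    positive definable, which is the interpretation
    ([pp_interpretation_exists]). This is a topological form of the theorem of
    Birkhoff that describes varieties by homomorphic images, subalgebras
    and powers.

    The reduction replaces each variable by a block of variables and
    each conjunct by the definition of the preimage of its relation, with a
    fresh block of auxiliary variables ([reduce], [reduceP]). It is computed by
    a Turing machine that scans its input once and keeps the numbers of the
    current block and of the arguments of the current conjunct in unary counters
    ([reduction_program]). The machine is compiled from a small language of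
    structured programs, for which running times add up along the program text
    ([runs_Seq], [runs_While_step], [program_computes]). *)

(** * Isomorphisms and oligomorphic structures *)

Definition isomorphism tau (A B : structure tau) (h : A -> B) : Prop :=
  bijective h /\
  forall (R : symbol tau) (t : (arity R).-tuple A),
    interp t <-> interp (map_tuple h t).

Definition oligomorphic tau (A : structure tau) : Prop :=
  countable [set: A] /\
  forall n, exists l : seq (n.-tuple A), forall t : n.-tuple A,
    exists2 h : A -> A, isomorphism h & map_tuple h t \in l.

Lemma map_tuple_id T n (t : n.-tuple T) : map_tuple id t = t.
Proof. by apply: val_inj; rewrite /= map_id. Qed.

Lemma map_tuple_comp S T U n (f : T -> U) (g : S -> T) (t : n.-tuple S) :
  map_tuple f (map_tuple g t) = map_tuple (f \o g) t.
Proof. by apply: val_inj; rewrite /= -map_comp. Qed.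

Lemma isomorphism_id tau (A : structure tau) : isomorphism (id : A -> A).
Proof. by split=> [|R t]; [exists id|rewrite map_tuple_id]. Qed.

Lemma isomorphism_comp tau (A B C : structure tau) (g : B -> C) (h : A -> B) :
  isomorphism g -> isomorphism h -> isomorphism (g \o h).
Proof.
move=> [bg hg] [bh hh]; split=> [|R t]; first exact: bij_comp.
by rewrite hh hg map_tuple_comp.
Qed.

Lemma isomorphism_inv tau (A B : structure tau) (h : A -> B) :
  isomorphism h -> exists g, [/\ isomorphism g, cancel h g & cancel g h].
Proof.
move=> [[g hK gK] hh]; exists g; split=> //; split=> [|R t]; first by exists h.
by rewrite hh map_tuple_comp (_ : h \o g = id) ?map_tuple_id//; exact/funext.
Qed.

Lemma countable_enum (T : Type) (x0 : T) :
  countable [set: T] -> exists e : nat -> T, forall x, exists k, e k = x.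
Proof.
move=> /countable_injP[g /= gI].
exists (fun k => if pselect (exists x, g x = k) is left h then projT1 (cid h) else x0).
move=> x; exists (g x); case: pselect => [h|[]]; last by exists x.
by apply: gI; rewrite ?in_setT//; case: cid.
Qed.

Lemma finite_oligomorphic tau (A : structure tau) :
  finite_set [set: A] -> oligomorphic A.
Proof.
move=> fA; split; first exact: finite_set_countable.
move=> n; case/finite_seqP: fA => s sE.
have sP x : x \in s by have : [set: A] x by []; rewrite sE.
exists (codom (fun t : n.-tuple (seq_sub s) => map_tuple val t)) => t.
exists id; first exact: isomorphism_id.
rewrite map_tuple_id; apply/codomP.
exists (map_tuple (fun x => SeqSub (sP x)) t).
by rewrite map_tuple_comp (_ : _ \o _ = id) ?map_tuple_id.
Qed.

Lemma tnth_cons_tuple T n (x : T) (t : n.-tuple T) (i : 'I_n) :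
  tnth (cons_tuple x t) (lift ord0 i) = tnth t i.
Proof. by rewrite !(tnth_nth x). Qed.

(** * First-order formulas *)

Section Formulas.
Variable tau : signature.

Definition map_atom n m (s : 'I_n -> 'I_m) (a : atom tau n) : atom tau m :=
  match a with
  | ABot => ABot tau m
  | AEq x y => AEq tau (s x) (s y)
  | ARel R t => ARel (map_tuple s t)
  end.

Lemma sat_map_atom (A : structure tau) n m (s : 'I_n -> 'I_m) (e : m.-tuple A)
    (a : atom tau n) :
  sat_atom e (map_atom s a) <-> sat_atom [tuple tnth e (s i) | i < n] a.
Proof.
case: a => [|x y|R t] //=; first by rewrite !tnth_mktuple.
rewrite map_tuple_comp; set t1 := map_tuple _ t; set t2 := map_tuple _ t.
suff -> : t1 = t2 by [].
by apply: eq_from_tnth => i; rewrite !tnth_map /= tnth_ord_tuple.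
Qed.

Definition lift_var n m (s : 'I_n -> 'I_m) (i : 'I_n.+1) : 'I_m.+1 :=
  if unlift ord0 i is Some j then lift ord0 (s j) else ord0.

(** Formulas are well scoped, so a set of assignments to infinitely many
    variables is described by formulas in different numbers of variables;
    renaming brings them to a common one. *)
Fixpoint rename n (f : formula tau n) : forall m, ('I_n -> 'I_m) -> formula tau m :=
  match f with
  | FAtom _ a => fun m s => FAtom (map_atom s a)
  | FImp _ g h => fun m s => FImp (rename g s) (rename h s)
  | FAll _ g => fun m s => FAll (rename g (lift_var s))
  end.

Lemma sat_rename (A : structure tau) n (f : formula tau n) m (s : 'I_n -> 'I_m)
    (e : m.-tuple A) :
  sat (rename f s) e <-> sat f [tuple tnth e (s i) | i < n].
Proof.
elim: f m s e => {n} [n a|n g IHg h IHh|n g IHg] m s e /=.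
- exact: sat_map_atom.
- by rewrite IHg IHh.
- have E d : [tuple tnth (cons_tuple d e) (lift_var s i) | i < n.+1] =
      cons_tuple d [tuple tnth e (s i) | i < n].
    apply: eq_from_tnth => i; rewrite tnth_mktuple /lift_var.
    case: unliftP => [j ->|->] //.
    by rewrite !tnth_cons_tuple tnth_mktuple.
  by split=> H d; [rewrite -E -IHg|rewrite IHg E].
Qed.

Definition FBot n : formula tau n := FAtom (ABot tau n).
Definition FNot n (f : formula tau n) : formula tau n := FImp f (FBot n).
Definition FAnd n (f g : formula tau n) : formula tau n := FNot (FImp f (FNot g)).
Definition FEx n (f : formula tau n.+1) : formula tau n := FNot (FAll (FNot f)).

Lemma sat_FAnd (A : structure tau) n (f g : formula tau n) (e : n.-tuple A) :
  sat (FAnd f g) e <-> sat f e /\ sat g e.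
Proof.
split=> /= [H|[sf sg] H]; last exact: H.
by split; apply: contrapT => nH; apply: H.
Qed.

Lemma sat_FEx (A : structure tau) n (f : formula tau n.+1) (e : n.-tuple A) :
  sat (FEx f) e <-> exists d, sat f (cons_tuple d e).
Proof.
split=> /= [H|[d sf] /(_ d)]; last exact.
by apply: contrapT => nH; apply: H => d sf; apply: nH; exists d.
Qed.

Fixpoint FExs k n : formula tau (k + n) -> formula tau n :=
  if k is k'.+1 then fun f => FExs (FEx (f : formula tau (k' + n).+1)) else fun f => f.

Lemma sat_FExs (A : structure tau) k n (f : formula tau (k + n)) (e : n.-tuple A) :
  sat (FExs f) e <-> exists y : k.-tuple A, sat f (cat_tuple y e).
Proof.
elim: k f => [|k IH] f /=.
  split=> [sf|[y]]; first by exists [tuple]; congr (sat f _): sf; exact: val_inj.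
  by rewrite [y]tuple0; congr (sat f _); exact: val_inj.
rewrite (IH (FEx f)); split=> [[y /sat_FEx[d sf]]|[y sf]].
  by exists (cons_tuple d y); congr (sat f _): sf; exact: val_inj.
exists (behead_tuple y); apply/sat_FEx; exists (thead y).
by congr (sat f _): sf; apply: val_inj; rewrite /= {1}(tuple_eta y).
Qed.

Fixpoint FConj n (fs : seq (formula tau n)) : formula tau n :=
  if fs is f :: fs' then FAnd f (FConj fs') else FNot (FBot n).

Lemma sat_FConj_map (A : structure tau) n (I : eqType) (fs : I -> formula tau n)
    (s : seq I) (e : n.-tuple A) :
  sat (FConj [seq fs i | i <- s]) e <-> forall i, i \in s -> sat (fs i) e.
Proof.
elim: s => [|i s IH]; first by split=> [_ j|_ []]; rewrite ?in_nil.
rewrite (_ : FConj _ = FAnd (fs i) (FConj [seq fs j | j <- s])) //.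
rewrite sat_FAnd IH; split=> [[H1 H2] j|H].
  by rewrite inE => /orP[/eqP ->//|/H2].
split=> [|j js]; apply: H; first exact: mem_head.
by rewrite inE js orbT.
Qed.

Lemma sat_isomorphism (A B : structure tau) (h : A -> B) : isomorphism h ->
  forall n (f : formula tau n) e, sat f e <-> sat f (map_tuple h e).
Proof.
move=> [[g hK gK] hh] n; elim=> {n} [n [|x y|R t]|n f IHf f' IHf'|n f IHf] e //=.
- by rewrite !tnth_map; split=> [->//|/(can_inj hK)].
- rewrite hh map_tuple_comp; set t1 := map_tuple _ t; set t2 := map_tuple _ t.
  suff -> : t1 = t2 by [].
  by apply: eq_from_tnth => i; rewrite !tnth_map.
- by rewrite IHf IHf'.
- have E d : map_tuple h (cons_tuple d e) = cons_tuple (h d) (map_tuple h e).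
    exact: val_inj.
  split=> H d; last by apply/IHf; rewrite E; exact: H.
  by rewrite -[d]gK -E -IHf.
Qed.

(** The generic construction below has one requirement for each formula and has
    to meet all of them in countably many steps. As the signature is finite,
    there are finitely many formulas of a given depth in given variables, and
    listing these avoids a coding of the dependent type of formulas. *)
Definition atoms n : seq (atom tau n) :=
  ABot tau n :: [seq AEq tau x y | x <- enum 'I_n, y <- enum 'I_n] ++
  flatten [seq [seq ARel t | t <- enum {: (arity R).-tuple 'I_n}] | R <- enum (symbol tau)].

Fixpoint formulas (k n : nat) : seq (formula tau n) :=
  [seq FAtom a | a <- atoms n] ++
  if k is k'.+1 then
    [seq FImp f g | f <- formulas k' n, g <- formulas k' n] ++
    [seq FAll f | f <- formulas k' n.+1]
  else [::].

(** Membership in a list over a type without decidable equality. *)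
Definition listed T (s : seq T) (x : T) := exists i, ohead (drop i s) = Some x.

Lemma listed_in (T : eqType) (s : seq T) x : x \in s -> listed s x.
Proof.
by move=> xs; exists (index x s); rewrite (drop_nth x) ?index_mem// nth_index.
Qed.

Lemma listed_catl T (s t : seq T) x : listed s x -> listed (s ++ t) x.
Proof.
move=> [i H]; exists i; rewrite drop_cat; case: ltnP => [_|si].
  by case: (drop i s) H.
by rewrite drop_oversize in H.
Qed.

Lemma listed_catr T (s t : seq T) x : listed t x -> listed (s ++ t) x.
Proof. by move=> [i H]; exists (i + size s); rewrite -drop_drop drop_size_cat. Qed.

Lemma listed_map S T (f : S -> T) s x : listed s x -> listed (map f s) (f x).
Proof. by move=> [i H]; exists i; rewrite -map_drop; case: drop H => //= y _ [->]. Qed.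

Lemma listed_allpairs R S T (f : R -> S -> T) s t x y :
  listed s x -> listed t y -> listed [seq f x y | x <- s, y <- t] (f x y).
Proof.
move=> [i]; elim: s i => [|z s IH] [|i] //= Hx Hy.
  by case: Hx => ->; apply: listed_catl; exact: listed_map.
by apply: listed_catr; exact: (IH i).
Qed.

Lemma listed_flatten (I : eqType) T (F : I -> seq T) s i x :
  i \in s -> listed (F i) x -> listed (flatten [seq F i | i <- s]) x.
Proof.
elim: s => //= j s IH; rewrite inE => /orP[/eqP <-|/IH H] Hx.
  exact: listed_catl.
by apply: listed_catr; exact: H.
Qed.

Lemma atomsP n (a : atom tau n) : listed (atoms n) a.
Proof.
case: a => [|x y|R t]; rewrite /atoms -cat1s.
- by apply: listed_catl; exists 0.
- by apply/listed_catr/listed_catl/listed_allpairs; apply: listed_in; rewrite mem_enum.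
- apply/listed_catr/listed_catr.
  apply: (@listed_flatten _ _ (fun R => [seq ARel t | t <- enum {: (arity R).-tuple 'I_n}]) _ R).
    by rewrite mem_enum.
  by apply/listed_map/listed_in; rewrite mem_enum.
Qed.

Lemma formulasP n (f : formula tau n) :
  exists k0, forall k, k0 <= k -> listed (formulas k n) f.
Proof.
elim: f => {n} [n a|n f [k1 H1] g [k2 H2]|n f [k1 H1]].
- by exists 0 => -[|k] _; apply/listed_catl/listed_map/atomsP.
- exists (maxn k1 k2).+1 => -[|k] //; rewrite ltnS geq_max => /andP[k1k k2k].
  by apply/listed_catr/listed_catl/listed_allpairs; [exact: H1|exact: H2].
- exists k1.+1 => -[|k] // k1k.
  by apply/listed_catr/listed_catr/listed_map/H1.
Qed.

(** [s] codes a depth, a position in the list of formulas of that depth, and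
    the indices; the values of indices beyond the coded list are immaterial. *)
Definition decode n (s : nat) : option (formula tau n * n.-tuple nat) :=
  if unpickle s is Some (k, i, t) then
    if ohead (drop i (formulas k n)) is Some f then
      Some (f, [tuple nth 0 t j | j < n])
    else None
  else None.

Lemma decodeP n (f : formula tau n) (t : n.-tuple nat) :
  exists s, decode n s = Some (f, t).
Proof.
have [k /(_ k (leqnn k))[i fi]] := formulasP f.
exists (pickle (k, i, tval t)); rewrite /decode pickleK fi.
by congr (Some (_, _)); apply: eq_from_tnth => j; rewrite tnth_mktuple (tnth_nth 0).
Qed.

End Formulas.

(** * Definable sets of assignments *)

Section Definable.
Variables (tau : signature) (A : structure tau).

(** Conditions of the generic construction constrain finitely many members of an
    infinite sequence [v] of elements. Using the whole sequence as the
    assignment makes intersections and fresh variables easy to express. *)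
Definition definable (S : set (nat -> A)) : Prop :=
  exists N (f : formula tau N), forall v, S v <-> sat f [tuple v i | i < N].

Definition holds n (f : formula tau n) (t : n.-tuple nat) : set (nat -> A) :=
  [set v | sat f (map_tuple v t)].

Lemma definable_widen S : definable S ->
  exists N0, forall N, N0 <= N ->
    exists f : formula tau N, forall v, S v <-> sat f [tuple v i | i < N].
Proof.
move=> [N0 [f fE]]; exists N0 => N N0N; exists (rename f (widen_ord N0N)) => v.
rewrite sat_rename fE (_ : [tuple _ | _ < _] = [tuple v i | i < N0]) //.
by apply: eq_from_tnth => i; rewrite !tnth_mktuple.
Qed.

Lemma definable_holds n (f : formula tau n) t : definable (holds f t).
Proof.
exists (\max_(i < n) tnth t i).+1.
exists (rename f (fun i => inord (tnth t i))) => v.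
rewrite sat_rename (_ : [tuple _ | _ < _] = map_tuple v t) //.
apply: eq_from_tnth => i; rewrite !(tnth_mktuple, tnth_map) inordK //.
exact: (leq_bigmax (F := fun i => tnth t i)).
Qed.

Lemma definableC S : definable S -> definable (~` S).
Proof.
move=> [N [f fE]]; exists N, (FNot f) => v /=.
by split=> [nS sf|nsf Sv]; [apply/nS/fE|apply/nsf/fE].
Qed.

Lemma definableI S T : definable S -> definable T -> definable (S `&` T).
Proof.
move=> /definable_widen[N1 H1] /definable_widen[N2 H2].
have [f fE] := H1 _ (leq_maxl N1 N2); have [g gE] := H2 _ (leq_maxr N1 N2).
exists (maxn N1 N2), (FAnd f g) => v; rewrite sat_FAnd -fE -gE.
by split=> -[].
Qed.

Definition update (v : nat -> A) k d : nat -> A := fun i => if i == k then d else v i.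

(** A definable set mentions finitely many variables, so every later one can be
    used as a witness for an existential statement. *)
Lemma definable_fresh S : definable S ->
  exists N, forall k, N <= k -> forall v d, S (update v k d) <-> S v.
Proof.
move=> [N [f fE]]; exists N => k Nk v d; rewrite !fE.
rewrite (_ : [tuple _ | _ < _] = [tuple v i | i < N]) //.
apply: eq_from_tnth => i; rewrite !tnth_mktuple /update.
by rewrite ltn_eqF // (leq_trans (ltn_ord i)).
Qed.

(** A projection is definable by an existential quantification over all the
    variables of the set; the equations tie those that are kept to the
    variables of the new formula. *)
Lemma definable_projection S n (t : n.-tuple nat) : definable S ->
  exists f : formula tau n, forall a, sat f a <-> exists2 v, S v & map_tuple v t = a.
Proof.
move=> /definable_widen[N0 H0].
pose N := maxn N0 (\max_(i < n) tnth t i).+1.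
have [f fE] := H0 N (leq_maxl _ _).
have tN i : tnth t i < N.
  by rewrite leq_max ltnS orbC (leq_bigmax (F := fun i => tnth t i)).
pose g := FAnd (rename f (@lshift N n)) (FConj [seq FAtom (AEq tau (lshift n (Ordinal (tN i)))
  (rshift N i)) | i <- enum 'I_n]).
exists (FExs g) => a; rewrite sat_FExs.
have E y : sat g (cat_tuple y a) <-> sat f y /\ forall i, tnth y (Ordinal (tN i)) = tnth a i.
  rewrite sat_FAnd sat_rename sat_FConj_map /=.
  rewrite (_ : [tuple _ | _ < _] = y); last first.
    by apply: eq_from_tnth => i; rewrite tnth_mktuple tnth_lshift.
  split=> -[sf H]; split=> // i; last by move=> _; rewrite tnth_lshift tnth_rshift.
  by have := H i; rewrite mem_enum tnth_lshift tnth_rshift; exact.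
split=> [[y /E[sf H]]|[v Sv vE]].
  pose i00 : 'I_N := Ordinal (leq_maxr N0 (\max_(i < n) tnth t i).+1 : _ < N).
  exists (fun k => nth (tnth y i00) y k).
    apply/fE; congr (sat f _): sf; apply: eq_from_tnth => i.
    by rewrite tnth_mktuple (tnth_nth (tnth y i00)).
  by apply: eq_from_tnth => i; rewrite tnth_map -H [RHS](tnth_nth (tnth y i00)).
exists [tuple v i | i < N]; apply/E; split; first exact/fE.
by move=> i; rewrite tnth_mktuple -vE tnth_map.
Qed.

End Definable.

Arguments holds {tau} A {n} f t.

(** * Generic models *)

Lemma dependent_choice T (R : nat -> T -> T -> Prop) (P : T -> Prop) x0 :
  P x0 -> (forall n x, P x -> exists y, P y /\ R n x y) ->
  exists u : nat -> T, [/\ u 0 = x0, forall n, P (u n) & forall n, R n (u n) (u n.+1)].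
Proof.
move=> Px0 H.
have /choice[next nextP] : forall p : nat * T, exists y, P p.2 -> P y /\ R p.1 p.2 y.
  move=> [n x]; have [Px|nPx] := pselect (P x); last by exists x.
  by have [y [Py Rxy]] := H n x Px; exists y.
pose u := fix u n := if n is m.+1 then next (m, u m) else x0.
have Pu n : P (u n) by elim: n => //= n /(nextP (n, _))[].
by exists u; split=> // n; have [] := nextP (n, u n) (Pu n).
Qed.

(** A Henkin construction that works with truth in [A] instead of provability:
    it produces a descending sequence of definable sets of assignments that
    decides every formula, provides a witness for each failing universal
    formula, and avoids a given ideal of small sets. With the empty set
    as the only small set this is the usual construction for omitting a type;
    with the sets that meet finitely many orbits it realises a type that no
    finite number of orbits exhausts. *)
Section Generic.
Variables (tau : signature) (A : structure tau) (n0 : nat).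
Variable small : set (nat -> A) -> Prop.
Hypothesis small0 : small set0.
Hypothesis smallU : forall S T, small S -> small T -> small (S `|` T).
Hypothesis small_proj : forall S T : set (nat -> A),
  (forall v, S v -> exists2 v', T v' & forall i, i < n0 -> v' i = v i) ->
  small T -> small S.

Definition large (S : set (nat -> A)) := definable S /\ ~ small S.

Lemma large_nonempty S : large S -> exists v, S v.
Proof.
move=> [_ nS]; apply: contrapT => H; apply: nS.
by rewrite (_ : S = set0)//; apply/seteqP; split=> // v Sv; case: H; exists v.
Qed.

Lemma large_split S T : large S -> definable T ->
  large (S `&` T) \/ large (S `&` ~` T).
Proof.
move=> [dS nS] dT; have [sST|] := pselect (small (S `&` T)); last first.
  by move=> H; left; split=> //; exact: definableI.
right; split; first by apply: definableI => //; exact: definableC.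
move=> sSnT; apply: nS; rewrite (_ : S = (S `&` T) `|` (S `&` ~` T)).
  exact: smallU.
by rewrite -setIUr setUv setIT.
Qed.

Lemma large_decide S n (f : formula tau n) t : large S ->
  exists S', [/\ large S', S' `<=` S &
    S' `<=` holds A f t \/ S' `<=` ~` holds A f t].
Proof.
move=> /large_split/(_ (definable_holds A f t))[] lS.
  by exists (S `&` holds A f t); split=> //; left=> v [].
by exists (S `&` ~` holds A f t); split=> //; right=> v [].
Qed.

(** The witness is a variable that occurs neither in the set nor in the
    formula and that is not among the first [n0], so the new set has the same
    projection to the first [n0] variables as the old one and stays large. *)
Lemma large_witness S n (f : formula tau n.+1) t : large S ->
  exists S', [/\ large S', S' `<=` S &
    S' `<=` holds A (FAll f) t \/
    exists k, S' `<=` ~` holds A f (cons_tuple k t)].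
Proof.
move=> /(large_decide (FAll f) t)[S' [lS' S'S []H]]; first by exists S'; split=> //; left.
have [N1 H1] := definable_fresh lS'.1.
pose k := maxn (maxn N1 n0) (\max_(i < n) tnth t i).+1.
have kt v d : map_tuple (update v k d) t = map_tuple v t.
  apply: eq_from_tnth => i; rewrite !tnth_map /update ltn_eqF//.
  by rewrite /k leq_max ltnS orbC (leq_bigmax (F := fun i => tnth t i)).
exists (S' `&` ~` holds A f (cons_tuple k t)); split; last by right; exists k => v [].
  split; first by apply: definableI lS'.1 _; exact/definableC/definable_holds.
  move=> sm; apply: lS'.2; apply: small_proj sm => v S'v.
  have : exists d, ~ sat f (cons_tuple d (map_tuple v t)).
    by apply: contrapT => nH; apply: (H _ S'v) => d; apply: contrapT => nd; apply: nH; exists d.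
  move=> [d nd]; exists (update v k d); last first.
    by move=> i i0; rewrite /update ltn_eqF// /k !leq_max i0 orbT.
  split; first by apply/H1 => //; rewrite /k !leq_max leqnn.
  rewrite /holds /=; move: nd; congr (~ sat f _); apply: val_inj => /=.
  by rewrite -[map (update v k d) t]/(val (map_tuple (update v k d) t)) kt /update eqxx.
by move=> v [/S'S].
Qed.

Variable req : nat -> set (nat -> A) -> Prop.
Hypothesis req_dense : forall s S, large S ->
  exists S', [/\ large S', S' `<=` S & req s S'].
Hypothesis largeT : large setT.

(** A code [c] stands for all requirements attached to a number [n] of variables
    and a code [s]: decide a formula, provide a witness, and the additional
    requirement number [s]. *)
Definition meets (c : nat) (S : set (nat -> A)) : Prop :=
  forall n s, unpickle c = Some (n, s) -> [/\
    forall f t, decode tau n s = Some (f, t) ->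
      S `<=` holds A f t \/ S `<=` ~` holds A f t,
    forall f t, decode tau n.+1 s = Some (f, t) ->
      S `<=` holds A (FAll f) (behead_tuple t) \/
      exists k, S `<=` ~` holds A f (cons_tuple k (behead_tuple t))
  & req s S].

Lemma meets_dense c S : large S -> exists S', large S' /\ (S' `<=` S /\ meets c S').
Proof.
move=> lS; rewrite /meets; case: (unpickle c) => [[n s]|]; last by exists S; split=> //; split.
have [S1 [lS1 SS1 H1]] : exists S', [/\ large S', S' `<=` S &
    forall f t, decode tau n s = Some (f, t) ->
      S' `<=` holds A f t \/ S' `<=` ~` holds A f t].
  case: (decode tau n s) => [[f t]|]; last by exists S; split.
  have [S' [lS' S'S H]] := large_decide f t lS.
  by exists S'; split=> // _ _ [<- <-].
have [S2 [lS2 SS2 H2]] : exists S', [/\ large S', S' `<=` S1 &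
    forall f t, decode tau n.+1 s = Some (f, t) ->
      S' `<=` holds A (FAll f) (behead_tuple t) \/
      exists k, S' `<=` ~` holds A f (cons_tuple k (behead_tuple t))].
  case: (decode tau n.+1 s) => [[f t]|]; last by exists S1; split.
  have [S' [lS' S'S H]] := large_witness f (behead_tuple t) lS1.
  by exists S'; split=> // _ _ [<- <-].
have [S3 [lS3 SS3 H3]] := req_dense s lS2.
exists S3; split=> //; split; first by move=> v /SS3/SS2/SS1.
move=> _ _ [<- <-]; split=> // f t.
  by move=> /H1[]H; [left|right] => v /SS3/SS2/H.
by move=> /H2[H|[k H]]; [left|right; exists k] => v /SS3/H.
Qed.

(** The elements of the model are the variables, two of them being identified
    when the generic sequence eventually forces them to be equal. A formula is
    true in the model exactly if it is eventually forced; the two directions of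
    transfer are stated through large sets because this is what later arguments
    by contradiction use. *)
Lemma generic_model : exists (B : structure tau) (c : nat -> B), [/\
  countable [set: B], forall b, exists k, c k = b,
  forall n (f : formula tau n) t, sat f (map_tuple c t) ->
    exists2 S, large S & S `<=` holds A f t
  & forall s, exists S, [/\ large S, req s S &
    forall n (f : formula tau n) t, S `<=` holds A f t -> sat f (map_tuple c t)]].
Proof.
have [u [u0 lu uS]] := dependent_choice largeT meets_dense.
have u_sub i j : i <= j -> u j `<=` u i.
  elim: j => [|j IH]; first by rewrite leqn0 => /eqP->.
  rewrite leq_eqVlt => /orP[/eqP->//|]; rewrite ltnS => /IH ij v /(uS j).1; exact: ij.
(* [ev] is the filter generated by the generic sequence. *)
pose ev (P : set (nat -> A)) := exists i, u i `<=` P.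
have evI P Q : ev P -> ev Q -> ev (P `&` Q).
  move=> [i iP] [j jQ]; exists (maxn i j) => v uv; split.
    by apply: iP; apply: u_sub uv; exact: leq_maxl.
  by apply: jQ; apply: u_sub uv; exact: leq_maxr.
have evS P Q : P `<=` Q -> ev P -> ev Q by move=> PQ [i iP]; exists i => v /iP/PQ.
have ev_forall n (P : 'I_n -> set (nat -> A)) :
    (forall i, ev (P i)) -> ev [set v | forall i, P i v].
  move=> /choice[g gP]; exists (\max_i g i) => v uv i; apply: (gP i).
  by apply: u_sub uv; exact: leq_bigmax.
have ev_ex P : ev P -> exists v, P v.
  by move=> [i iP]; have [v /iP Pv] := large_nonempty (lu i); exists v.
have ev_dec n (f : formula tau n) t : ev (holds A f t) \/ ev (~` holds A f t).
  have [s sE] := decodeP f t.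
  have [_] := uS (pickle (n, s)); rewrite /meets pickleK => /(_ _ _ erefl)[H _ _].
  by have [{}H|{}H] := H _ _ sE; [left|right]; exists (pickle (n, s)).+1.
have ev_wit n (f : formula tau n.+1) t : ev (holds A (FAll f) t) \/
    exists k, ev (~` holds A f (cons_tuple k t)).
  have [s sE] := decodeP f (cons_tuple 0 t).
  have tE : behead_tuple (cons_tuple 0 t) = t by exact: val_inj.
  have [_] := uS (pickle (n, s)); rewrite /meets pickleK => /(_ _ _ erefl)[_ H _].
  have := H _ _ sE; rewrite tE => -[{}H|[k {}H]].
    by left; exists (pickle (n, s)).+1.
  by right; exists k, (pickle (n, s)).+1.
pose eqv j k := ev [set v | v j = v k].
have eqv_dec j k : eqv j k \/ ev [set v | v j <> v k].
  have := ev_dec _ (FAtom (AEq tau (ord0 : 'I_2) (lift ord0 ord0))) [tuple j; k].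
  by rewrite /holds /= => -[]; [left|right].
have exr k : exists j, `[< eqv j k >] by exists k; apply/asboolP; exists 0.
(* Each class is represented by its least member. *)
pose r k := ex_minn (exr k).
have rP k : eqv (r k) k by rewrite /r; case: ex_minnP => j /asboolP.
have eqv_sym j k : eqv j k -> eqv k j by apply: evS => v /= ->.
have eqv_trans j k l : eqv j k -> eqv k l -> eqv j l.
  by move=> jk kl; apply: evS (evI _ _ jk kl) => v /= [-> ->].
have r_eqv j k : eqv j k -> r j = r k.
  move=> jk; apply: eq_ex_minn => l; apply/asboolP/asboolP => [lj|lk].
    exact: eqv_trans jk.
  by apply: eqv_trans lk _; exact: eqv_sym.
have rK k : r (r k) == r k by apply/eqP/r_eqv/rP.
pose D : choiceType := {k : nat | r k == k}.
pose B : structure tau := @Structure tau D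
  (fun R => [set t | ev (holds A (FAtom (ARel [tuple i | i < arity R])) (map_tuple val t))]).
pose c (k : nat) : B := exist _ (r k) (rK k).
have valc (b : B) : c (val b) = b by apply: val_inj => /=; exact/eqP/(valP b).
have ev_c n (f : formula tau n) t :
    ev (holds A f (map_tuple val (map_tuple c t))) <-> ev (holds A f t).
  have : ev [set v | forall i, v (r (tnth t i)) = v (tnth t i)].
    by apply: ev_forall => i; exact: rP.
  have E v : (forall i, v (r (tnth t i)) = v (tnth t i)) ->
      map_tuple v (map_tuple val (map_tuple c t)) = map_tuple v t.
    by move=> H; apply: eq_from_tnth => i; rewrite !tnth_map H.
  by move=> evE; split=> /(evI _ _ evE); apply: evS => v /= [/E]; rewrite /holds /= => ->.
have truth n (f : formula tau n) (e : n.-tuple B) :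
    sat f e <-> ev (holds A f (map_tuple val e)).
  elim: f e => {n} [n [|x y|R t]|n f IHf g IHg|n f IHf] e.
  - by split=> // /ev_ex[v].
  - have E : holds A (FAtom (AEq tau x y)) (map_tuple val e) =
        [set v | v (val (tnth e x)) = v (val (tnth e y))].
      by apply: funext => v; rewrite /holds /mkset /= !tnth_map.
    rewrite E /=; split=> [->|/r_eqv]; first by exists 0.
    by rewrite (eqP (valP (tnth e x))) (eqP (valP (tnth e y))) => /val_inj.
  - rewrite /= /holds /=.
    suff E (v : nat -> A) : map_tuple (tnth (map_tuple v (map_tuple val (map_tuple (tnth e) t))))
        [tuple i | i < arity R] = map_tuple (tnth (map_tuple v (map_tuple val e))) t.
      by split; apply: evS => v /=; rewrite E.
    by apply: eq_from_tnth => i; rewrite !tnth_map ?tnth_ord_tuple ?tnth_map.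
  - rewrite /= IHf IHg; split=> [fg|].
      have [evf|evnf] := ev_dec _ f (map_tuple val e).
        by apply: evS (fg evf) => v hg _.
      by apply: evS evnf => v nf hf; case: (nf hf).
    move=> efg ef; apply: evS (evI _ _ efg ef) => v [fg]; exact: fg.
  - have E d : map_tuple val (cons_tuple d e) = cons_tuple (val d) (map_tuple val e).
      exact: val_inj.
    have Ev (v : nat -> A) k : map_tuple v (cons_tuple k (map_tuple val e)) =
      cons_tuple (v k) (map_tuple v (map_tuple val e)) by exact: val_inj.
    split=> /= [H|evf d].
      have [//|[k evk]] := ev_wit _ f (map_tuple val e).
      have /IHf : sat f (cons_tuple (c k) e) by exact: H.
      rewrite E => evf; have [v []] := ev_ex _ (evI _ _ (rP k) (evI _ _ evk evf)).
      by rewrite /holds /= !Ev => -> [].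
    apply/IHf; rewrite E; apply: evS evf => v hv.
    by rewrite /holds /= Ev; exact: hv.
exists B, c; split.
- exact: countableP.
- by move=> b; exists (val b).
- by move=> n f t /truth/ev_c[i ui]; exists (u i).
- move=> s; exists (u (pickle (0, s)).+1); split=> //.
    by have [_] := uS (pickle (0, s)); rewrite /meets pickleK => /(_ _ _ erefl)[].
  by move=> n f t uf; apply/truth/ev_c; exists (pickle (0, s)).+1.
Qed.

End Generic.

(** * The theorem of Ryll-Nardzewski *)

Section RyllNardzewski.
Variables (tau : signature) (A : structure tau).

Definition same_type n (a b : n.-tuple A) : Prop :=
  forall f : formula tau n, sat f a <-> sat f b.

Lemma same_typeW n (a b : n.-tuple A) :
  (forall f : formula tau n, sat f a -> sat f b) -> same_type a b.
Proof.
move=> H f; split; first exact: H.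
by move=> sb; apply: contrapT => na; exact: (H (FNot f) na).
Qed.

Lemma same_type_sym n (a b : n.-tuple A) : same_type a b -> same_type b a.
Proof. by move=> H f; split=> /H. Qed.

Definition isolates n (f : formula tau n) (a : n.-tuple A) : Prop :=
  sat f a /\ forall b, sat f b -> same_type a b.

Section Atomic.
Hypothesis atomic : forall n (a : n.-tuple A), exists f, isolates f a.

(** The existence of an extension that satisfies the isolating formula of
    [c :: a] is part of the type of [a], hence of that of [b]. *)
Lemma same_type_extend n (a b : n.-tuple A) c : same_type a b ->
  exists d, same_type (cons_tuple c a) (cons_tuple d b).
Proof.
move=> ab; have [f [fa fP]] := atomic (cons_tuple c a).
have /ab/sat_FEx[d fd] : sat (FEx f) a by apply/sat_FEx; exists c.
by exists d; exact: fP.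
Qed.

(** A list of pairs is a finite partial map; the back-and-forth argument keeps it
    elementary. *)
Definition same_types (L : seq (A * A)) : Prop :=
  same_type (map_tuple fst (in_tuple L)) (map_tuple snd (in_tuple L)).

Lemma same_typesE n (t : n.-tuple (A * A)) :
  same_types t <-> same_type (map_tuple fst t) (map_tuple snd t).
Proof.
rewrite /same_types; move: (in_tuple t) (erefl : tval (in_tuple t) = tval t).
rewrite size_tuple => u ut; suff -> : u = t by [].
exact: val_inj.
Qed.

Lemma same_types_cons L c d :
  same_types ((c, d) :: L) <->
  same_type (cons_tuple c (map_tuple fst (in_tuple L)))
            (cons_tuple d (map_tuple snd (in_tuple L))).
Proof.
rewrite (same_typesE (cons_tuple (c, d) (in_tuple L))).
set a := map_tuple fst _; set a' := cons_tuple c _.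
set b := map_tuple snd _; set b' := cons_tuple d _.
have -> : a = a' by exact: val_inj.
by have -> : b = b' by exact: val_inj.
Qed.

Lemma same_types_forth L c : same_types L -> exists d, same_types ((c, d) :: L).
Proof.
by move=> /(same_type_extend c)[d H]; exists d; apply/same_types_cons.
Qed.

Lemma same_types_back L d : same_types L -> exists c, same_types ((c, d) :: L).
Proof.
move=> /same_type_sym/(same_type_extend d)[c H]; exists c.
exact/same_types_cons/same_type_sym.
Qed.

Lemma same_types_atom (L : seq (A * A)) n (t : n.-tuple (A * A)) (a : atom tau n) :
  same_types L -> {subset t <= L} ->
  (sat_atom (map_tuple fst t) a <-> sat_atom (map_tuple snd t) a).
Proof.
move=> sL tL; have ltL i : index (tnth t i) L < size L.
  by rewrite index_mem; apply: tL; exact: mem_tnth.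
have E (p : A * A -> A) :
    [tuple tnth (map_tuple p (in_tuple L)) (Ordinal (ltL i)) | i < n] = map_tuple p t.
  apply: eq_from_tnth => i; rewrite !(tnth_mktuple, tnth_map); congr p.
  by rewrite (tnth_nth (tnth t i)) /= nth_index//; apply: tL; exact: mem_tnth.
have := sL (FAtom (map_atom (fun i => Ordinal (ltL i)) a)).
by rewrite /= !sat_map_atom !E.
Qed.

(** Back and forth along an enumeration of [A]: the finite partial maps grow to
    the graph of an automorphism. *)
Lemma same_type_isomorphism n (a b : n.-tuple A) (x0 : A) :
  countable [set: A] -> same_type a b ->
  exists2 h : A -> A, isomorphism h & map_tuple h a = b.
Proof.
move=> /(countable_enum x0)[en enP] ab.
have L0P : same_types [tuple (tnth a i, tnth b i) | i < n].
  apply/same_typesE; set a' := map_tuple _ _; set b' := map_tuple _ _.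
  have -> : a' = a by apply: eq_from_tnth => i; rewrite tnth_map tnth_mktuple.
  by have -> : b' = b by apply: eq_from_tnth => i; rewrite tnth_map tnth_mktuple.
pose R k (L L' : seq (A * A)) :=
  {subset L <= L'} /\ exists c d, (en k, d) \in L' /\ (c, en k) \in L'.
have step k L : same_types L -> exists L', same_types L' /\ R k L L'.
  move=> /(same_types_forth (en k))[d Hd].
  have [c H] := same_types_back (en k) Hd.
  eexists; split; first exact: H.
  split=> [p pL|]; first by rewrite !inE pL !orbT.
  by exists c, d; rewrite !inE !eqxx orbT.
have [u [u0 uP uS]] := dependent_choice L0P step.
have u_sub i j : i <= j -> {subset u i <= u j}.
  elim: j => [|j IH]; first by rewrite leqn0 => /eqP->.
  rewrite leq_eqVlt => /orP[/eqP->//|]; rewrite ltnS => /IH ij x /ij.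
  exact: (uS j).1.
have forth x : exists y k, (x, y) \in u k.
  by have [k <-] := enP x; have [_ [c [d [H _]]]] := uS k; exists d, k.+1.
have back y : exists x k, (x, y) \in u k.
  by have [k <-] := enP y; have [_ [c [d [_ H]]]] := uS k; exists c, k.+1.
have [h hP] := choice forth; have [g gP] := choice back.
have all_in m (t : m.-tuple (A * A)) : (forall i, exists k, tnth t i \in u k) ->
    exists k, {subset t <= u k}.
  move=> /choice[f fP]; exists (\max_i f i) => x /tnthP[i ->].
  by apply: u_sub (fP i); exact: leq_bigmax.
have pair p q : (exists k, p \in u k) -> (exists k, q \in u k) ->
    (p.1 = q.1 <-> p.2 = q.2).
  move=> pu qu; have [|k kP] := all_in 2 [tuple p; q].
    by move=> i; rewrite (tnth_nth p); case: i => -[|[|]].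
  have := same_types_atom (AEq tau (ord0 : 'I_2) (lift ord0 ord0)) (uP k) kP.
  by rewrite /= !(tnth_map, tnth_nth p).
exists h; last first.
  apply: eq_from_tnth => i; rewrite tnth_map.
  have /pair/(_ (hP (tnth a i)))/= : exists k, (tnth a i, tnth b i) \in u k.
    exists 0; rewrite u0; apply/tnthP; exists i; by rewrite tnth_mktuple.
  by case=> /(_ erefl).
split; first exists g.
- by move=> x; apply: (pair _ _ (gP (h x)) (hP x)).2.
- by move=> y; apply: (pair _ _ (hP (g y)) (gP y)).1.
move=> S t; have [|k kP] := all_in _ (map_tuple (fun x => (x, h x)) t).
  by move=> i; rewrite tnth_map.
have := same_types_atom (ARel [tuple i | i < arity S]) (uP k) kP.
rewrite /=; set t1 := map_tuple _ _; set t2 := map_tuple _ [tuple i | i < _].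
have -> : t1 = t.
  by apply: eq_from_tnth => i; rewrite !tnth_map tnth_ord_tuple.
suff -> : t2 = map_tuple h t by [].
by apply: eq_from_tnth => i; rewrite !tnth_map tnth_ord_tuple.
Qed.

End Atomic.

Section Categorical.
Hypothesis catA : omega_categorical A.
Variable x0 : A.

Let countA : countable [set: A] := catA.1.

(** The generic model is countable and satisfies the theory of [A], so by
    categoricity it is [A] itself: the generic sequence enumerates [A]. *)
Lemma generic_isomorphism n0 small : forall
  (small0 : small set0)
  (smallU : forall S T : set (nat -> A), small S -> small T -> small (S `|` T))
  (small_proj : forall S T : set (nat -> A),
     (forall v, S v -> exists2 v', T v' & forall i, i < n0 -> v' i = v i) ->
     small T -> small S)
  (req : nat -> set (nat -> A) -> Prop)
  (req_dense : forall s S, large small S ->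
     exists S', [/\ large small S', S' `<=` S & req s S'])
  (largeT : large small setT),
  exists c : nat -> A, [/\ forall b, exists k, c k = b,
  forall n (f : formula tau n) t, sat f (map_tuple c t) ->
    exists2 S, large small S & S `<=` holds A f t
  & forall s, exists S, [/\ large small S, req s S &
    forall n (f : formula tau n) t, S `<=` holds A f t -> sat f (map_tuple c t)]].
Proof.
move=> small0 smallU small_proj req req_dense largeT.
have [B [c [cB c_onto cS reqS]]] :=
  generic_model small0 smallU small_proj req_dense largeT.
have BA : model_of B (theory A).
  move=> f Af; have [S [_ _ /(_ 0 f [tuple])]] := reqS 0.
  rewrite /theory /= (_ : map_tuple c [tuple] = [tuple]); last exact: val_inj.
  apply=> v _; rewrite /holds /= (_ : map_tuple v [tuple] = [tuple]) //.
  exact: val_inj.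
have [h bh hh] := catA.2 B cB BA.
have hI : isomorphism h by [].
have E n (f : formula tau n) t : sat f (map_tuple (h \o c) t) <-> sat f (map_tuple c t).
  by rewrite -map_tuple_comp -(sat_isomorphism hI).
exists (h \o c); split.
- move=> b; have [g hK gK] := bh; have [k ck] := c_onto (g b).
  by exists k; rewrite /= ck gK.
- by move=> n f t /E/cS.
- by move=> s; have [S [? ? H]] := reqS s; exists S; split=> // n f t /H/E.
Qed.

(** If the type of [a] were not isolated, each condition on a tuple of variables
    could be strengthened so that some formula true at [a] fails at that tuple.
    The generic enumeration of [A] would then omit [a]. *)
Lemma categorical_atomic n (a : n.-tuple A) : exists f, isolates f a.
Proof.
apply: contrapT => nf.
pose small (S : set (nat -> A)) := S = set0.
(* [s] codes the tuple of variables at which the type of [a] is to be omitted. *)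
pose req s (S : set (nat -> A)) := let t := [tuple nth 0 (odflt [::] (unpickle s)) i | i < n] in
  exists2 f : formula tau n, sat f a & S `<=` ~` holds A f t.
have := @generic_isomorphism 0 small erefl _ _ req.
case.
- by move=> S T -> ->; rewrite setU0.
- move=> S T H T0; apply/seteqP; split=> // v /H[v']; by rewrite T0.
- move=> s S lS; apply: contrapT => nS.
  pose t := [tuple nth 0 (odflt [::] (unpickle s)) i | i < n].
  have St v : S v -> same_type a (map_tuple v t).
    move=> Sv; apply: same_typeW => f fa; apply: contrapT => nfv; apply: nS.
    exists (S `&` ~` holds A f t); split=> [||]; last by exists f => // u [].
      split; first exact/definableI/definableC/definable_holds/(lS.1).
      by move=> H; have : set0 v by rewrite -H.
    by move=> u [].
  have [f fE] := definable_projection t lS.1.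
  have [v Sv] := large_nonempty (erefl : small set0) lS.
  apply: nf; exists f; split; first by apply/(St v Sv)/fE; exists v.
  by move=> b /fE[u Su <-]; exact: St.
- split; first by exists 0, (FNot (FBot tau 0)) => v; split=> // _ [].
  by move=> H; have : set0 (fun _ : nat => x0) by rewrite -H.
move=> c [c_onto _ reqP].
have /choice[k kP] : forall i, exists k, c k = tnth a i by [].
have [S [_ [f fa Sf] SP]] := reqP (pickle (tval [tuple k i | i < n])).
have /= := SP _ (FNot f) [tuple k i | i < n].
rewrite (_ : map_tuple c _ = a); last first.
  by apply: eq_from_tnth => i; rewrite tnth_map tnth_mktuple.
apply=> // v /Sf; rewrite pickleK /= (_ : [tuple nth _ _ _ | _ < _] = [tuple k i | i < n]) //.
by apply: eq_from_tnth => i; rewrite !tnth_mktuple (nth_map i) ?size_enum_ord // nth_ord_enum.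
Qed.

(** Otherwise the sets of assignments whose first [n] values meet infinitely many
    orbits are large, and a generic enumeration of [A] starts with a tuple such
    that each formula true at it holds in infinitely many orbits.
    But its type is isolated, and the tuples that satisfy the isolating formula
    form a single orbit. *)
Lemma categorical_finitely_many_orbits n : exists l : seq (n.-tuple A), forall t : n.-tuple A,
    exists2 h : A -> A, isomorphism h & map_tuple h t \in l.
Proof.
pose small (S : set (nat -> A)) := exists l : seq (n.-tuple A), forall v, S v ->
    exists2 h : A -> A, isomorphism h & map_tuple h [tuple v i | i < n] \in l.
have tE (t : n.-tuple A) : t = [tuple nth x0 t i | i < n].
  by apply: eq_from_tnth => i; rewrite tnth_mktuple (tnth_nth x0).
apply: contrapT => nl.
have := @generic_isomorphism n small _ _ _ (fun _ _ => True).
case.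
- by exists [::].
- move=> S T [l1 H1] [l2 H2]; exists (l1 ++ l2) => v [/H1|/H2][h ih hl]; exists h => //;
  by rewrite mem_cat hl ?orbT.
- move=> S T H [l lP]; exists l => v /H[v' /lP[h ih hl] v'v]; exists h => //.
  rewrite (_ : [tuple v i | i < n] = [tuple v' i | i < n]) //.
  by apply: eq_from_tnth => i; rewrite !tnth_mktuple v'v.
- by move=> s S lS; exists S; split.
- split; first by exists 0, (FNot (FBot tau 0)) => v; split=> // _ [].
  by move=> [l lP]; apply: nl; exists l => t; rewrite (tE t); exact: lP.
move=> c [_ cS _].
have [f [fa fP]] := categorical_atomic (map_tuple c [tuple val i | i < n]).
have [S [_ nS] Sf] := cS _ _ _ fa.
apply: nS; exists [:: map_tuple c [tuple val i | i < n]] => v /Sf fv.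
have st : same_type [tuple v i | i < n] (map_tuple c [tuple val i | i < n]).
  apply: same_type_sym; apply: fP; move: fv; rewrite /holds /=; congr (sat f _).
  by apply: eq_from_tnth => i; rewrite tnth_map !tnth_mktuple.
have [h ih hv] := same_type_isomorphism categorical_atomic x0 countA st.
by exists h => //; rewrite hv mem_head.
Qed.

End Categorical.
End RyllNardzewski.

Lemma omega_categorical_oligomorphic tau (A : structure tau) :
  omega_categorical A -> oligomorphic A.
Proof.
move=> catA; have [[x0 _]|nA] := pselect (exists x : A, True); last first.
  apply: finite_oligomorphic; rewrite (_ : [set: A] = set0) //.
  by apply/seteqP; split=> // x _; case: nA; exists x.
by split=> [|n]; [exact: catA.1|exact: categorical_finitely_many_orbits x0 n].
Qed.

(** * Compactness modulo automorphisms *)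

(** Finitely many [r] cannot all drop out at some stage. *)
Lemma pigeonhole (T : choiceType) (l : seq T) (Q : T -> nat -> Prop) :
  (forall r M N, M <= N -> Q r N -> Q r M) ->
  (forall N, exists2 r, r \in l & Q r N) -> exists r, forall N, Q r N.
Proof.
move=> Qle H; apply: contrapT => nQ.
have /choice[g gP] : forall r, exists N, ~ Q r N.
  move=> r; apply: contrapT => nr; apply: nQ; exists r => N.
  by apply: contrapT => nN; apply: nr; exists N.
have [r rl] := H (\max_(r <- l) g r); apply: contra_not (gP r).
by apply: Qle; exact: leq_bigmax_seq.
Qed.

Section Compactness.
Variables (tau : signature) (A : structure tau).
Hypothesis oA : oligomorphic A.

(** The values of the limit [h] along an enumeration of [X] are chosen one at a
    time, such that at each stage the chosen values are realised by infinitely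
    many of the [f i] up to an automorphism. For the next value there are
    finitely many possibilities up to automorphisms of [A], so one of them
    occurs infinitely often. *)
Lemma compactness (X : choiceType) (f : nat -> X -> A) : countable [set: X] ->
  exists h : X -> A, forall (F : seq X) N, exists i, N <= i /\
    exists2 b : A -> A, isomorphism b & {in F, forall x, h x = b (f i x)}.
Proof.
move=> cX; have [[x0 _]|nX] := pselect (exists x : X, True); last first.
  exists (fun x => f 0 x) => F N; exists N; split=> //.
  by exists id => [|x _]; [exact: isomorphism_id|case: nX; exists x].
have [e eP] := countable_enum x0 cX; pose a0 := f 0 x0.
pose agree (s : seq A) i (b : A -> A) := forall j, j < size s -> nth a0 s j = b (f i (e j)).
pose P (s : seq A) := forall N, exists i, N <= i /\ exists2 b, isomorphism b & agree s i b.
have P0 : P [::] by move=> N; exists N; split=> //; exists id => //; exact: isomorphism_id.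
pose R (k : nat) (s s' : seq A) := exists a, s' = rcons s a.
have step k s : P s -> exists s', P s' /\ R k s s'.
  move=> Ps; set n := size s; have [l lP] := oA.2 n.+1.
  pose t i : n.+1.-tuple A := [tuple f i (e j) | j < n.+1].
  pose Q (r : n.+1.-tuple A) N := exists i, N <= i /\ exists b g,
    [/\ isomorphism b, isomorphism g, agree s i b & map_tuple (g \o b) (t i) = r].
  have [|N|r rQ] := @pigeonhole _ l Q.
  - by move=> r M N MN [i [Ni H]]; exists i; split=> //; exact: leq_trans Ni.
  - have [i [Ni [b ib bs]]] := Ps N; have [g ig gl] := lP (map_tuple b (t i)).
    exists (map_tuple g (map_tuple b (t i))) => //; exists i; split=> //.
    by exists b, g; split=> //; rewrite map_tuple_comp.
  (* The representative [r] extends an image of [s], not [s] itself; any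
     occurrence provides the automorphism [g0] that has to be undone. *)
  have [i0 [_ [b0 [g0 [ib0 ig0 bs0 r0]]]]] := rQ 0.
  have [g' [ig' g0K g'K]] := isomorphism_inv ig0.
  exists (rcons s (g' (tnth r ord_max))); split; last by eexists.
  move=> N; have [i [Ni [b [g [ib ig bs rE]]]]] := rQ N; exists i; split=> //.
  exists (g' \o (g \o b)); first by do ![apply: isomorphism_comp => //].
  have rj j (jn : j < n.+1) : g (b (f i (e j))) = tnth r (Ordinal jn).
    by rewrite -rE tnth_map tnth_mktuple.
  move=> j; rewrite size_rcons -/n => jn; rewrite nth_rcons /= (rj _ jn).
  have /orP[jE|js] : (j == n) || (j < n) by rewrite -leq_eqVlt -ltnS.
    rewrite ltn_neqAle jE /=; congr (g' (tnth _ _)).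
    by apply: val_inj; exact/esym/eqP.
  by rewrite js bs0// -r0 tnth_map tnth_mktuple /= g0K.
have [u [u0 uP uS]] := dependent_choice P0 step.
have su n : size (u n) = n.
  by elim: n => [|n IH]; [rewrite u0|have [a ->] := uS n; rewrite size_rcons IH].
have u_nth i j k : k < i -> i <= j -> nth a0 (u j) k = nth a0 (u i) k.
  move=> ki; elim: j => [|j IH]; first by rewrite leqn0 => /eqP->.
  rewrite leq_eqVlt => /orP[/eqP->//|]; rewrite ltnS => ij.
  by have [a ->] := uS j; rewrite nth_rcons su (leq_trans ki ij) IH.
have [c cP] := choice eP.
exists (fun x => nth a0 (u (c x).+1) (c x)) => F N.
pose n := (\max_(x <- F) c x).+1.
have [i [Ni [b ib bu]]] := uP n N; exists i; split=> //; exists b => // x xF.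
have cn : c x < n by rewrite ltnS; exact: leq_bigmax_seq.
by rewrite -(@u_nth _ n)// bu ?su// cP.
Qed.

End Compactness.

(** * Primitive positive definability of invariant relations *)

Lemma tnth_index (T : eqType) (s : seq T) x (xs : index x s < size s) :
  tnth (in_tuple s) (Ordinal xs) = x.
Proof. by rewrite (tnth_nth x) /= nth_index// -index_mem. Qed.

Section PPDefinability.
Variables (tau : signature) (A : structure tau).

Definition all_sat n (e : n.-tuple A) (s : seq (atom tau n)) : Prop :=
  foldr (fun a P => sat_atom e a /\ P) True s.

Lemma all_sat_cat n (e : n.-tuple A) s1 s2 :
  all_sat e (s1 ++ s2) <-> all_sat e s1 /\ all_sat e s2.
Proof. by elim: s1 => [|a s1 IH] /=; [split=> [|[]]|rewrite IH and_assoc]. Qed.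

Lemma all_sat_map n (e : n.-tuple A) (I : eqType) (s : seq I) (F : I -> atom tau n) :
  all_sat e [seq F i | i <- s] <-> forall i, i \in s -> sat_atom e (F i).
Proof.
elim: s => [|i s IH] /=; first by split.
rewrite IH; split=> [[Fi H] j|H]; first by rewrite inE => /orP[/eqP->|/H].
split=> [|j js]; apply: H; first exact: mem_head.
by rewrite inE js orbT.
Qed.

Lemma all_sat_flatten n (e : n.-tuple A) (I : eqType) (s : seq I) (F : I -> seq (atom tau n)) :
  all_sat e (flatten [seq F i | i <- s]) <-> forall i, i \in s -> all_sat e (F i).
Proof.
elim: s => [|i s IH] /=; first by split.
rewrite all_sat_cat IH; split=> [[Fi H] j|H]; first by rewrite inE => /orP[/eqP->|/H].
split=> [|j js]; apply: H; first exact: mem_head.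
by rewrite inE js orbT.
Qed.

Definition pp_definable n (R : set (n.-tuple A)) : Prop :=
  exists l (phi : seq (atom tau (n + l))), forall u,
    R u <-> exists y : l.-tuple A, all_sat (cat_tuple u y) phi.

Definition apply_tuples (B : choiceType) k (f : operation B k) n
    (us : k.+1.-tuple (n.-tuple B)) : n.-tuple B :=
  [tuple f (map_tuple (fun u => tnth u j) us) | j < n].

Definition Pol_invariant n (R : set (n.-tuple A)) : Prop :=
  forall k (f : operation A k), homomorphism (f : power A k.+1 -> A) ->
  forall us : k.+1.-tuple (n.-tuple A), (forall i, R (tnth us i)) ->
  R (apply_tuples f us).

Definition unary_op (h : A -> A) : operation A 0 := fun x => h (tnth x ord0).

Lemma isomorphism_Pol (h : A -> A) : isomorphism h ->
  homomorphism (unary_op h : power A 1 -> A).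
Proof.
move=> [_ hh] R t /(_ ord0)/hh; congr interp.
by apply: eq_from_tnth => i; rewrite !tnth_map.
Qed.

Lemma invariant_isomorphism n (R : set (n.-tuple A)) h u :
  Pol_invariant R -> isomorphism h -> R u -> R (map_tuple h u).
Proof.
move=> iR /isomorphism_Pol ih Ru.
have := iR _ _ ih [tuple u]; rewrite (_ : apply_tuples _ _ = map_tuple h u).
  by apply=> i; rewrite (tnth_nth u); case: i => -[].
by apply: eq_from_tnth => i; rewrite tnth_mktuple tnth_map /unary_op tnth_map (tnth_nth u).
Qed.

(** Stated with lists instead of an enumeration because [T] may be empty. *)
Lemma countable_exhaustion (T : choiceType) : countable [set: T] ->
  exists E : nat -> seq T, forall F : seq T, exists N, forall i, N <= i -> {subset F <= E i}.
Proof.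
have [[x0 _]|nT _] := pselect (exists x : T, True); last first.
  by exists (fun=> [::]) => F; exists 0 => i _ x; case: nT; exists x.
move=> /(countable_enum x0)[e /choice[c cP]]; exists (fun i => [seq e j | j <- iota 0 i]) => F.
exists (\max_(x <- F) c x).+1 => i Fi x xF; apply/mapP; exists (c x); last by rewrite cP.
by rewrite mem_iota; apply: leq_trans Fi; rewrite ltnS; exact: leq_bigmax_seq.
Qed.

Lemma countable_tuple n (T : choiceType) : countable [set: T] -> countable [set: n.-tuple T].
Proof.
move=> /countable_injP[g gI]; apply/countable_injP.
exists (fun t => pickle (map_tuple g t)) => t1 t2 _ _ /(pcan_inj pickleK) E.
apply: eq_from_tnth => i; have := congr1 (fun t => tnth t i) E.
by rewrite !tnth_map => /gI ->//; rewrite in_setT.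
Qed.

Section PartialHomomorphisms.
Variables (k n : nat) (c : 'I_n -> k.+1.-tuple A) (D : seq (k.+1.-tuple A)).
Let m := size D.
Let pt (i : 'I_m) : power A k.+1 := tnth (in_tuple D) i.

(** The first [n] variables stand for the values at the points [c j] and the
    others for the values at the points of [D]. *)
Definition partial_hom_formula : seq (atom tau (n + m)) :=
  [seq AEq tau (lshift m p.1) (rshift n p.2) |
     p <- enum {: 'I_n * 'I_m} & pt p.2 == c p.1] ++
  flatten [seq [seq ARel (map_tuple (@rshift n m) t) |
     t <- enum {: (arity R).-tuple 'I_m} & `[< interp (map_tuple pt t) >]] |
     R <- enum (symbol tau)].

Lemma partial_hom_formulaP (u : n.-tuple A) (y : m.-tuple A) :
  all_sat (cat_tuple u y) partial_hom_formula <->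
  (forall j i, pt i = c j -> tnth u j = tnth y i) /\
  (forall R (t : (arity R).-tuple 'I_m), interp (map_tuple pt t) ->
     interp (map_tuple (tnth y) t)).
Proof.
rewrite all_sat_cat all_sat_map all_sat_flatten; split=> -[H1 H2]; split.
- move=> j i pc; have := H1 (j, i); rewrite mem_filter pc eqxx mem_enum => /(_ isT).
  by rewrite /= tnth_lshift tnth_rshift.
- move=> R t pt_t; have := H2 R; rewrite mem_enum => /(_ isT)/all_sat_map/(_ t).
  rewrite mem_filter mem_enum andbT => /(_ (asboolT pt_t)) /=.
  congr interp; apply: eq_from_tnth => i; by rewrite !tnth_map tnth_rshift.
- move=> [j i]; rewrite mem_filter => /andP[/eqP/H1 E _].
  by rewrite /= tnth_lshift tnth_rshift.
- move=> R _; apply/all_sat_map => t; rewrite mem_filter => /andP[/asboolP/H2 + _].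
  congr interp; apply: eq_from_tnth => i; by rewrite !tnth_map tnth_rshift.
Qed.

End PartialHomomorphisms.

(** The relation [R] is generated by representatives [gen] of its orbits, and
    [c j] lists their coordinates at [j]: the tuples in [R] are the
    [(f (c 0), .., f (c n.-1))] for polymorphisms [f]. Requiring
    [f] to be a homomorphism on a finite set [D i] only is primitive positive
    and allows at least the tuples in [R]. The sets [D i] exhaust the
    power; if each of them allowed a tuple outside [R], the corresponding partial homomorphisms would
    accumulate at a polymorphism that maps [gen] to a tuple outside [R]. *)
Theorem invariant_pp_definable n (R : set (n.-tuple A)) :
  oligomorphic A -> Pol_invariant R -> pp_definable R.
Proof.
move=> oA iR.
have [[u0 Ru0]|nR] := pselect (exists u, R u); last first.
  exists 0, [:: ABot tau _] => u; split=> [Ru|[y []]//].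
  by case: nR; exists u.
have [l lP] := oA.2 n.
pose rs := [seq r <- l | `[< R r >]].
have rsP u : R u -> exists h r, [/\ isomorphism h, r \in rs & map_tuple h r = u].
  move=> Ru; have [h ih hl] := lP u; have [g [ig hK gK]] := isomorphism_inv ih.
  exists g, (map_tuple h u); split=> //.
    by rewrite mem_filter hl andbT; apply/asboolP; exact: invariant_isomorphism.
  by rewrite map_tuple_comp (_ : g \o h = id) ?map_tuple_id//; apply/funext.
have rsR r : r \in rs -> R r by rewrite mem_filter => /andP[/asboolP].
have [k sk] : exists k, size rs == k.+1.
  by have [_ [r [_ + _]]] := rsP _ Ru0; case: rs {rsP rsR} => // r' rs' _; exists (size rs').
pose gen : k.+1.-tuple (n.-tuple A) := Tuple sk.
pose c j : k.+1.-tuple A := map_tuple (fun u => tnth u j) gen.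
have [E EP] := countable_exhaustion (countable_tuple k.+1 oA.1).
pose D i := undup (codom c ++ E i).
apply: contrapT => nR.
have ex_w i : exists w : n.-tuple A * (size (D i)).-tuple A,
    ~ R w.1 /\ all_sat (cat_tuple w.1 w.2) (partial_hom_formula c (D i)).
  apply: contrapT => nw; apply: nR.
  exists (size (D i)), (partial_hom_formula c (D i)) => u; split=> [Ru|[y yP]]; last first.
    by apply: contrapT => nRu; apply: nw; exists (u, y).
  have [h [r [ih rrs <-]]] := rsP u Ru.
  have /tnthP[a ra] : r \in gen by [].
  exists (map_tuple (fun x => h (tnth x a)) (in_tuple (D i))).
  apply/partial_hom_formulaP; split=> [j b|S t /(_ a)/ih.2].
    by rewrite !tnth_map => ->; rewrite tnth_map -ra.
  congr interp; apply: eq_from_tnth => b; by rewrite !tnth_map.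
pose w i := projT1 (cid (ex_w i)); have wP i := projT2 (cid (ex_w i)); rewrite -/(w _) in wP.
pose f i (x : k.+1.-tuple A) : A :=
  nth (tnth x ord0) (w i).2 (index x (D i)).
have fE i a : f i (tnth (in_tuple (D i)) a) = tnth (w i).2 a.
  have ia : index (tnth (in_tuple (D i)) a) (D i) = a.
    rewrite (tnth_nth (tnth (in_tuple (D i)) a)) /= index_uniq//.
    exact: undup_uniq.
  by rewrite /f ia -tnth_nth.
have [h hP] := compactness oA f (countable_tuple k.+1 oA.1).
have h_hom : homomorphism (h : power A k.+1 -> A).
  move=> S t tS; have [N NP] := EP t.
  have [i [Ni [b ib hb]]] := hP t N.
  have tD a : index (tnth t a) (D i) < size (D i).
    by rewrite index_mem mem_undup mem_cat (NP i Ni) ?orbT// mem_tnth.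
  have ptE : map_tuple (tnth (in_tuple (D i))) [tuple Ordinal (tD a) | a < arity S] = t.
    apply: eq_from_tnth => a; rewrite tnth_map tnth_mktuple.
    exact: tnth_index.
  have [_ /(_ S [tuple Ordinal (tD a) | a < arity S])] := (partial_hom_formulaP _ _ _).1 (wP i).2.
  rewrite ptE => /(_ tS)/ib.2; congr interp.
  apply: eq_from_tnth => a; rewrite [RHS]tnth_map [LHS]tnth_map [X in b X]tnth_map.
  rewrite tnth_mktuple hb ?mem_tnth// -fE.
  by rewrite tnth_index.
have [i [_ [b ib hb]]] := hP (codom c) 0.
have [cu _] := (partial_hom_formulaP _ _ _).1 (wP i).2.
apply: (wP i).1; have [b' [ib' bK _]] := isomorphism_inv ib.
have := iR _ _ h_hom gen (fun a => rsR _ (mem_tnth a gen)).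
move=> /(invariant_isomorphism iR ib'); congr R.
apply: eq_from_tnth => j; rewrite tnth_map /apply_tuples tnth_mktuple -/(c j) hb ?codom_f// bK.
have cD : index (c j) (D i) < size (D i).
  by rewrite index_mem mem_undup mem_cat codom_f.
by rewrite (cu j (Ordinal cD)) -?fE tnth_index.
Qed.

End PPDefinability.

(** * Continuity of maps between clones *)

(** The sets that contain a basic neighbourhood of [f] form a filter that
    converges to [f] in every coordinate, hence in the product. *)
Lemma ptws_nbhs_finite (D : choiceType) k (f : operation D k) (U : set (operation D k)) :
  nbhs f U -> exists F : seq (k.+1.-tuple D), forall g : operation D k,
    {in F, f =1 g} -> U g.
Proof.
pose W (V : set (operation D k)) := exists F : seq (k.+1.-tuple D), forall g : operation D k,
    {in F, f =1 g} -> V g.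
have WF : Filter W.
  split.
  - by exists [::].
  - move=> P Q [F1 h1] [F2 h2]; exists (F1 ++ F2) => g gE; split.
      by apply: h1 => x xF; apply: gE; rewrite mem_cat xF.
    by apply: h2 => x xF; apply: gE; rewrite mem_cat xF orbT.
  - by move=> P Q PQ [F hF]; exists F => g /hF /PQ.
suff : (nbhs f `<=` W) by apply.
apply/(@cvg_sup _ _ _ W f) => i A [B [[V oV <-] Bf] BA].
exists [:: i] => g gE; apply: BA.
by rewrite /= -gE ?mem_head.
Qed.

Lemma eval_nbhs (D : choiceType) k (f : operation D k) (b : k.+1.-tuple D) :
  nbhs f [set g : operation D k | g b = f b].
Proof.
have /(_ f [set f b]) := @proj_continuous _ (fun _ : k.+1.-tuple D => discrete_topology D) b.
by apply; exact: discrete_set1.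
Qed.

(** The operations whose value at [b] is prescribed form an open set, and a
    neighbourhood of [f] contains all operations that agree with [f] on some
    finite set. *)
Lemma clone_map_continuous_finite (D E : choiceType) (C : clone D) (C' : clone E)
    (xi : forall k, C k -> C' k) (k : nat) (f : C k) (b : k.+1.-tuple E) :
  continuous (clone_map xi) ->
  exists F : seq (k.+1.-tuple D), forall g : C k,
    {in F, set_val f =1 set_val g} -> set_val (xi k f) b = set_val (xi k g) b.
Proof.
move=> cxi.
pose op (g : C k) : clone_set C :=
  exist _ (existT _ k (set_val g)) (mem_set (set_valP g)).
have opE (g : C k) : exist _ (projT2 (set_val (op g))) (mem_set (set_valP (op g))) = g.
  by case: g => g pg /=; congr exist; exact: bool_irrelevance.
pose V : set (operations E) := existT _ k @` [set g : operation E k | g b = set_val (xi k f) b].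
have nV : nbhs (set_val (clone_map xi (op f))) V.
  have := @existT_nbhs _ (operation E) k _ _ (eval_nbhs (set_val (xi k f)) b).
  by rewrite /clone_map /= opE.
have := @initial_continuous _ _ (set_val : clone_set C' -> operations E) _ _ nV.
move=> /cxi [B [[U oU UE] Bf] BV].
have nU : nbhs (existT _ k (set_val f) : operations D) U.
  apply: open_nbhs_nbhs; split => //.
  by move: Bf; rewrite -UE.
have [F hF] := ptws_nbhs_finite nU.
exists F => g /hF Ug.
have /BV : B (op g) by rewrite -UE.
case=> h hb; rewrite /clone_map /= opE.
by move=> /(@inj_pair2_eq_dec _ Nat.eq_dec (operation E)) <-.
Qed.

(** * Primitive positive interpretations *)

(** Variables come in [b] blocks of [K]; variable number [i * K + o] is the one at
    offset [o] of block [i]. This numbering is easy to produce in unary. *)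
Section Blocks.
Variables (b K : nat).

Lemma block_index_subproof (i : 'I_b) (o : 'I_K) : i * K + o < b * K.
Proof.
by apply: (@leq_trans (i.+1 * K)); [rewrite mulSnr ltn_add2l|rewrite leq_mul2r ltn_ord orbT].
Qed.

Definition block_index i o : 'I_(b * K) := Ordinal (block_index_subproof i o).

Lemma block_slot_subproof (v : 'I_(b * K)) : v %/ K < b.
Proof.
move: (nat_of_ord v) (ltn_ord v) => x.
by case: (posnP K) => [->|K0]; rewrite ?muln0// ltn_divLR.
Qed.

Definition block_slot v : 'I_b := Ordinal (block_slot_subproof v).

Lemma block_offset_subproof (v : 'I_(b * K)) : v %% K < K.
Proof.
apply: ltn_pmod; move: (nat_of_ord v) (ltn_ord v) => x.
by case: (posnP K) => [->|//]; rewrite muln0.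
Qed.

Definition block_offset v : 'I_K := Ordinal (block_offset_subproof v).

Lemma block_slotK i o : block_slot (block_index i o) = i.
Proof.
apply: val_inj => /=; have K0 : 0 < K by case: (K) o => // -[].
by rewrite divnMDl// divn_small ?addn0.
Qed.

Lemma block_offsetK i o : block_offset (block_index i o) = o.
Proof. by apply: val_inj => /=; rewrite modnMDl modn_small. Qed.

Lemma block_indexK v : block_index (block_slot v) (block_offset v) = v.
Proof. by apply: val_inj; rewrite /= -divn_eq. Qed.

Definition flatten_blocks T (B : 'I_b -> K.-tuple T) : (b * K).-tuple T :=
  [tuple tnth (B (block_slot v)) (block_offset v) | v < b * K].

Definition block T (e : (b * K).-tuple T) (i : 'I_b) : K.-tuple T :=
  [tuple tnth e (block_index i o) | o < K].

Lemma tnth_flatten_blocks T (B : 'I_b -> K.-tuple T) i o :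
  tnth (flatten_blocks B) (block_index i o) = tnth (B i) o.
Proof. by rewrite tnth_mktuple block_slotK block_offsetK. Qed.

Lemma flatten_blocksK T (B : 'I_b -> K.-tuple T) i : block (flatten_blocks B) i = B i.
Proof. by apply: eq_from_tnth => o; rewrite tnth_mktuple tnth_flatten_blocks. Qed.

Lemma blockK T (e : (b * K).-tuple T) : flatten_blocks (block e) = e.
Proof. by apply: eq_from_tnth => v; rewrite tnth_mktuple tnth_mktuple block_indexK. Qed.

End Blocks.

(** The first letter of an encoded conjunct determines its number of arguments
    and its meaning, so equality, falsity and the relations can be treated
    alike. *)
Section Letters.
Variable sigma : signature.

Definition letter : finType := (symbol sigma + mark)%type.

Definition letter_arity (a : letter) : nat :=
  match a with inl R => arity R | inr Equal => 2 | inr _ => 0 end.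

Definition letter_holds (G : structure sigma) (a : letter) :
    (letter_arity a).-tuple G -> Prop :=
  match a with
  | inl R => fun t => interp t
  | inr Equal => fun t => tnth t (ord0 : 'I_2) = tnth t (lift ord0 ord0 : 'I_2)
  | inr Bottom => fun=> False
  | inr _ => fun=> True
  end.

End Letters.

Lemma all_sat_map_atom tau (A : structure tau) n m (s : 'I_n -> 'I_m) (e : m.-tuple A)
    (l : seq (atom tau n)) :
  all_sat e [seq map_atom s a | a <- l] <-> all_sat [tuple tnth e (s i) | i < n] l.
Proof. by elim: l => //= a l ->; rewrite sat_map_atom. Qed.

(** The set of tuples that represent an element is defined by a conjunction of
    atoms without auxiliary variables, at the price of a larger dimension: the
    auxiliary variables become coordinates. In the gadget of a letter, block [0]
    holds the auxiliary variables and block [i.+1] represents argument [i]. *)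
Record pp_interpretation sigma tau (G : structure sigma) (D : structure tau) := PPInterpretation {
  dim : nat;
  represents : dim.-tuple D -> G -> Prop;
  domain_gadget : seq (atom tau (1 * dim));
  letter_gadget : forall a : letter sigma, seq (atom tau ((letter_arity a).+1 * dim));
  represented : forall x, exists B, represents B x;
  domain_gadgetP : forall B,
    all_sat (flatten_blocks (fun _ : 'I_1 => B)) domain_gadget <->
    exists x, represents B x;
  letter_gadgetP : forall a (Bs : 'I_(letter_arity a) -> dim.-tuple D)
      (xs : (letter_arity a).-tuple G),
    (forall i, represents (Bs i) (tnth xs i)) ->
    (letter_holds xs <-> exists C, all_sat (flatten_blocks
      (fun i : 'I_(letter_arity a).+1 => if unlift ord0 i is Some j then Bs j else C))
      (letter_gadget a))
}.

(** A partial map [rep] from [d]-tuples onto [G] that is compatible with the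
    polymorphisms of both structures is an interpretation, as the preimages of
    the relations are then invariant. *)
Section Interpretation.
Variables (sigma tau : signature) (G : structure sigma) (D : structure tau).

Variables (d : nat) (rep : d.-tuple D -> G -> Prop).
Hypothesis rep_fun : forall u v v', rep u v -> rep u v' -> v = v'.
Hypothesis rep_surj : forall v, exists u, rep u v.
Hypothesis oD : oligomorphic D.
Hypothesis rep_compat : forall k (f : operation D k),
  homomorphism (f : power D k.+1 -> D) ->
  exists2 g : operation G k, homomorphism (g : power G k.+1 -> G) &
  forall (us : k.+1.-tuple (d.-tuple D)) (vs : k.+1.-tuple G),
    (forall i, rep (tnth us i) (tnth vs i)) -> rep (apply_tuples f us) (g vs).

Definition rep_letter (a : letter sigma) : set ((letter_arity a * d).-tuple D) :=
  [set e | exists2 xs : (letter_arity a).-tuple G,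
     forall i, rep (block e i) (tnth xs i) & letter_holds xs].

Arguments rep_letter : clear implicits.

Lemma block_apply_tuples k (f : operation D k) r
    (us : k.+1.-tuple ((r * d).-tuple D)) (i : 'I_r) :
  block (apply_tuples f us) i = apply_tuples f (map_tuple (fun e => block e i) us).
Proof.
apply: eq_from_tnth => o; rewrite !tnth_mktuple; congr f.
by apply: eq_from_tnth => j; rewrite !tnth_map tnth_ord_tuple.
Qed.

Lemma letter_holds_Pol (a : letter sigma) k (g : operation G k) :
  homomorphism (g : power G k.+1 -> G) ->
  forall xs : k.+1.-tuple ((letter_arity a).-tuple G),
  (forall j, letter_holds (tnth xs j)) -> letter_holds (apply_tuples g xs).
Proof.
move=> hg; case: a => [R|[]] //= xs Hx; last first.
- rewrite !tnth_mktuple; congr g; apply: eq_from_tnth => j.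
  by rewrite !tnth_map; exact: Hx.
- exact: (Hx ord0).
pose t : (arity R).-tuple (power G k.+1) :=
  [tuple map_tuple (fun u => tnth u j) xs | j < arity R].
have := hg R t; rewrite (_ : map_tuple g t = apply_tuples g xs).
  apply=> j; rewrite (_ : map_tuple _ t = tnth xs j) //.
  by apply: eq_from_tnth => i; rewrite tnth_map tnth_mktuple tnth_map.
by apply: eq_from_tnth => i; rewrite tnth_map !tnth_mktuple.
Qed.

Lemma invariant_rep_domain : Pol_invariant [set u | exists v, rep u v].
Proof.
move=> k f /rep_compat[g _ fg] us /choice[x xP].
exists (g [tuple x i | i < k.+1]); apply: fg => i.
by rewrite tnth_mktuple; exact: xP.
Qed.

Lemma invariant_rep_letter (a : letter sigma) : Pol_invariant (rep_letter a).
Proof.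
move=> k f /rep_compat[g hg fg] us Hus.
have /choice[x xP] : forall i, exists xs, (forall j, rep (block (tnth us i) j) (tnth xs j)) /\
    @letter_holds _ G a xs by move=> i; have [xs] := Hus i; exists xs.
exists (apply_tuples g [tuple x i | i < k.+1]) => [j|].
  rewrite block_apply_tuples tnth_mktuple; apply: fg => i.
  rewrite !tnth_map tnth_ord_tuple; exact: (xP i).1.
apply: letter_holds_Pol => // j; rewrite tnth_mktuple; exact: (xP j).2.
Qed.

(** A representing block consists of a tuple in the domain of [rep], the
    auxiliary variables that witness this, and padding that makes it large
    enough to hold the auxiliary variables of any gadget. The padding can be
    filled with [y0]. *)
Lemma interpretation_of_rep (y0 : D) : inhabited (pp_interpretation G D).
Proof.
have [l0 [phi0 phi0P]] := invariant_pp_definable oD invariant_rep_domain.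
have defl a := invariant_pp_definable oD (@invariant_rep_letter a).
pose l a := projT1 (cid (defl a)).
pose phi a := projT1 (cid (projT2 (cid (defl a)))).
have phiP a : forall u, rep_letter a u <-> exists y : (l a).-tuple D, all_sat (cat_tuple u y) (phi a)
  := projT2 (cid (projT2 (cid (defl a)))).
pose K := d + l0 + \sum_a l a.
have dK : d <= K by rewrite /K -addnA leq_addr.
have lK a : l a <= K.
  by rewrite /K (bigD1 a) //= addnCA leq_addr.
pose pre (B : K.-tuple D) : d.-tuple D := [tuple tnth B (widen_ord dK i) | i < d].
pose repr (B : K.-tuple D) x := rep (pre B) x /\
  all_sat [tuple tnth B (lshift _ i) | i < d + l0] phi0.
pose dg := [seq map_atom (fun i => block_index (ord0 : 'I_1) (lshift (\sum_a l a) i)) a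
           | a <- phi0].
pose var a (v : 'I_(letter_arity a * d + l a)) : 'I_((letter_arity a).+1 * K) :=
  match fintype.split v with
  | inl i => block_index (lift ord0 (block_slot i)) (widen_ord dK (block_offset i))
  | inr j => block_index ord0 (widen_ord (lK a) j)
  end.
pose lg a := [seq map_atom (@var a) b | b <- phi a].
suff [H1 H2 H3] : [/\ (forall x, exists B, repr B x),
    (forall B, all_sat (flatten_blocks (fun _ : 'I_1 => B)) dg <-> exists x, repr B x) &
    (forall a (Bs : 'I_(letter_arity a) -> K.-tuple D) (xs : (letter_arity a).-tuple G),
    (forall i, repr (Bs i) (tnth xs i)) ->
    (letter_holds xs <-> exists C, all_sat (flatten_blocks
      (fun i : 'I_(letter_arity a).+1 => if unlift ord0 i is Some j then Bs j else C))
      (lg a)))].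
  exact: inhabits (PPInterpretation H1 H2 H3).
split.
- move=> x; have [u ux] := rep_surj x.
  have [y uy] : exists y : l0.-tuple D, all_sat (cat_tuple u y) phi0 by apply/phi0P; exists x.
  have nthE (i : 'I_(d + l0)) : nth y0 (u ++ y) i = tnth (cat_tuple u y) i by rewrite (tnth_nth y0).
  exists [tuple nth y0 (u ++ y) i | i < K]; split.
    congr (rep _ x): ux; apply: eq_from_tnth => i; rewrite !tnth_mktuple /=.
    by rewrite nth_cat size_tuple ltn_ord (tnth_nth y0).
  congr (all_sat _ _): uy; apply: eq_from_tnth => i; rewrite !tnth_mktuple.
  by rewrite -nthE.
- move=> B; rewrite all_sat_map_atom.
  rewrite (_ : [tuple tnth _ _ | _ < _] =
    [tuple tnth B (lshift (\sum_a l a) i) | i < d + l0]); last first.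
    by apply: eq_from_tnth => i; rewrite [LHS]tnth_mktuple [RHS]tnth_mktuple tnth_flatten_blocks.
  split=> [H|[x []]//].
  suff [x px] : exists x, rep (pre B) x by exists x.
  apply/phi0P; exists [tuple tnth B (lshift _ (rshift d i)) | i < l0].
  congr (all_sat _ _): H; apply: eq_from_tnth => i; rewrite tnth_mktuple.
  by rewrite -(splitK i); case: (fintype.split i) => j /=;
    rewrite ?tnth_lshift ?tnth_rshift tnth_mktuple; congr (tnth B _); exact: val_inj.
- move=> a Bs xs BsP.
  pose e := flatten_blocks (fun i => pre (Bs i)).
  have eP : letter_holds xs <-> rep_letter a e.
    split=> [H|[xs' xs'P]].
      by exists xs => // i; rewrite flatten_blocksK; exact: (BsP i).1.
    suff -> : xs' = xs by [].
    apply: eq_from_tnth => i; apply: rep_fun (xs'P i) _.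
    by rewrite flatten_blocksK; exact: (BsP i).1.
  rewrite eP phiP.
  have E C y : (forall j, tnth y j = tnth C (widen_ord (lK a) j)) ->
      (all_sat (flatten_blocks (fun i : 'I_(letter_arity a).+1 =>
         if unlift ord0 i is Some j then Bs j else C)) (lg a) <->
       all_sat (cat_tuple e y) (phi a)).
    move=> yC; rewrite all_sat_map_atom; set e1 := mktuple _.
    suff -> : e1 = cat_tuple e y by [].
    apply: eq_from_tnth => v; rewrite tnth_mktuple -[in RHS](splitK v) /var.
    case: (fintype.split v) => j /=; rewrite tnth_flatten_blocks.
      by rewrite liftK tnth_lshift !tnth_mktuple.
    by rewrite unlift_none tnth_rshift yC.
  split=> [[y yP]|[C CP]].
    exists [tuple nth y0 y i | i < K]; apply/E; last exact: yP.
    by move=> j; rewrite tnth_mktuple (tnth_nth y0).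
  exists [tuple tnth C (widen_ord (lK a) j) | j < l a]; apply/E; last exact: CP.
  by move=> j; rewrite tnth_mktuple.
Qed.

End Interpretation.

(** * Interpretations from continuous clone homomorphisms *)

Section Birkhoff.
Variables (sigma tau : signature) (G : structure sigma) (D : structure tau).
Variable xi : forall k, Pol D k -> Pol G k.
Hypothesis xi_hom : clone_homomorphism xi.
Hypothesis xi_surj : forall k (g : Pol G k), exists f, xi f = g.
Hypothesis xi_cont : continuous (clone_map xi).
Hypothesis oG : oligomorphic G.
Hypothesis oD : oligomorphic D.

(** Operations in a clone are pairs of a function and a proof; a relation
    between the functions alone spares the transport of proofs. *)
Definition xi_graph k (f : operation D k) (g : operation G k) : Prop :=
  exists2 p : Pol D k, set_val p = f & set_val (xi p) = g.

Lemma xi_graph_dom k f : homomorphism (f : power D k.+1 -> D) ->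
  exists2 g, @xi_graph k f g & homomorphism (g : power G k.+1 -> G).
Proof.
move=> hf; pose p : Pol D k := exist _ (f : operation D k) (mem_set (hf : Pol D k f)).
exists (set_val (xi p)); first by exists p.
exact: (set_valP (xi p)).
Qed.

Lemma xi_graph_hom k f g : @xi_graph k f g ->
  homomorphism (f : power D k.+1 -> D) /\ homomorphism (g : power G k.+1 -> G).
Proof. by move=> [p <- <-]; split; [exact: (set_valP p)|exact: (set_valP (xi p))]. Qed.

Lemma xi_graph_fun k f g g' : @xi_graph k f g -> xi_graph f g' -> g = g'.
Proof.
move=> [p pf <-] [p' p'f <-]; rewrite (_ : p = p')//.
by apply: val_inj; rewrite -!set_valE pf.
Qed.

Lemma xi_graph_surj k g : homomorphism (g : power G k.+1 -> G) -> exists f, @xi_graph k f g.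
Proof.
move=> hg; have [p pE] := xi_surj (exist _ (g : operation G k) (mem_set (hg : Pol G k g))).
by exists (set_val p); exists p => //; rewrite pE.
Qed.

Lemma xi_graph_proj k (i : 'I_k.+1) : xi_graph (@proj_op D k i) (@proj_op G k i).
Proof. by exists (clone_proj_elt (Pol D) i) => //; rewrite xi_hom.1. Qed.

Lemma xi_graph_comp n m f g (fs : 'I_n.+1 -> operation D m) gs :
  @xi_graph n f g -> (forall i, xi_graph (fs i) (gs i)) ->
  xi_graph (comp_op f fs) (comp_op g gs).
Proof.
move=> [p pf pg] H; pose q i := projT1 (cid2 (H i)).
have [qf qg] : (forall i, set_val (q i) = fs i) /\ (forall i, set_val (xi (q i)) = gs i).
  by split=> i; rewrite /q; case: cid2.
exists (clone_comp_elt p q); rewrite ?xi_hom.2 /= ?set_valE /=.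
  by rewrite -pf; congr comp_op; exact: funext.
by rewrite -pg; congr comp_op; exact: funext.
Qed.

Lemma xi_graph_continuous k f g (b : k.+1.-tuple G) : xi_graph f g ->
  exists F : seq (k.+1.-tuple D), forall f' g', xi_graph f' g' ->
    {in F, f =1 f'} -> g b = g' b.
Proof.
move=> [p <- <-]; have [F FP] := clone_map_continuous_finite p b xi_cont.
by exists F => _ _ [q <- <-] /FP.
Qed.

(** The image of an automorphism is invertible because [xi] preserves
    composition and projections. *)
Lemma xi_graph_unary_inj a c : isomorphism a -> xi_graph (unary_op a) c ->
  injective (fun x => c [tuple x]).
Proof.
move=> ia cP; have [a' [ia' aK _]] := isomorphism_inv ia.
have [c' c'P _] := xi_graph_dom (isomorphism_Pol ia').
have H1 := xi_graph_comp c'P (fun _ : 'I_1 => cP).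
have H2 := xi_graph_proj (ord0 : 'I_1).
have E : comp_op (unary_op a') (fun _ : 'I_1 => unary_op a) = @proj_op D 0 ord0.
  by apply: funext => t; rewrite /comp_op /unary_op tnth_mktuple aK.
rewrite E in H1; have {}E := xi_graph_fun H1 H2.
move=> x y /(congr1 (fun z => c' [tuple z])) H.
have Ex z : c' [tuple c [tuple z]] = z.
  have := congr1 (fun f => f [tuple z]) E; rewrite /comp_op /proj_op.
  rewrite (_ : [tuple _ | _ < _] = [tuple c [tuple z]]); last first.
    by apply: eq_from_tnth => i; rewrite tnth_mktuple (tnth_nth z); case: i => -[].
  by rewrite (tnth_nth z).
by rewrite -(Ex x) -(Ex y).
Qed.

(** If no finite set works, then there are pairs of operations that agree on
    finite sets which exhaust the domain and whose images differ at [b]. Up to automorphisms the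
    pairs accumulate, and both of their members accumulate at the same
    polymorphism [h]. By continuity at [h] the images agree at [b] after
    application of the image of an automorphism, which is injective. *)
Lemma xi_graph_uniform k (b : k.+1.-tuple G) :
  exists F : seq (k.+1.-tuple D), forall f f' g g', xi_graph f g -> xi_graph f' g' ->
    {in F, f =1 f'} -> g b = g' b.
Proof.
have cX := countable_tuple k.+1 oD.1.
have [E EP] := countable_exhaustion cX.
apply: contrapT => nF.
have /choice[p pP] : forall i, exists p :
      (operation D k * operation G k) * (operation D k * operation G k),
    [/\ xi_graph p.1.1 p.1.2, xi_graph p.2.1 p.2.2, {in E i, p.1.1 =1 p.2.1} & p.1.2 b <> p.2.2 b].
  move=> i; apply: contrapT => np; apply: nF; exists (E i) => f f' g g' fg fg' ff'.
  by apply: contrapT => gg'; apply: np; exists ((f, g), (f', g')).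
have [h hP] := compactness oD (fun i => (p i).1.1 : k.+1.-tuple D -> D) cX.
have h_hom : homomorphism (h : power D k.+1 -> D).
  move=> R t tR; have [i [_ [a ia ha]]] := hP t 0.
  have [/xi_graph_hom[hf _] _ _ _] := pP i.
  rewrite (_ : map_tuple h t = map_tuple a (map_tuple (p i).1.1 t)).
    by have /ia.2 := hf _ _ tR.
  by apply: eq_from_tnth => j; rewrite !tnth_map ha// mem_tnth.
have [gh hg _] := xi_graph_dom h_hom.
have [F FP] := xi_graph_continuous b hg; have [N NP] := EP F.
have [i [Ni [a ia ha]]] := hP F N; have [Xf Xf' ff' gg'] := pP i.
have [c ac _] := xi_graph_dom (isomorphism_Pol ia).
have Ec f g : xi_graph f g -> {in F, (p i).1.1 =1 f} -> gh b = c [tuple g b].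
  move=> fg fF; rewrite (FP _ _ (xi_graph_comp ac (fun _ : 'I_1 => fg))).
    rewrite /comp_op; congr c; apply: eq_from_tnth => j.
    by rewrite tnth_mktuple (tnth_nth (g b)); case: j => -[].
  by move=> x xF; rewrite /comp_op /unary_op tnth_mktuple ha// fF.
apply: gg'; apply: (xi_graph_unary_inj ia ac).
rewrite -(Ec _ _ Xf)// -(Ec _ _ Xf')// => x xF.
by apply: ff'; apply: NP.
Qed.

(** Representatives of the orbits of elements generate [G] already under the
    automorphisms. *)
Lemma oligomorphic_generators (y : G) : exists k (b : k.+1.-tuple G), forall x,
  exists2 g : operation G k, homomorphism (g : power G k.+1 -> G) & g b = x.
Proof.
have [l lP] := oG.2 1.
have [k sk] : exists k, size l == k.+1.
  by have [h _ /= hl] := lP [tuple y]; case: l {lP} hl => // u l _; exists (size l).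
pose L : k.+1.-tuple (1.-tuple G) := Tuple sk.
exists k, (map_tuple (fun u => tnth u ord0) L) => x.
have [h ih hl] := lP [tuple x]; have [h' [ih' hK _]] := isomorphism_inv ih.
have /tnthP[i iE] : map_tuple h [tuple x] \in L by [].
exists (comp_op (unary_op h') (fun _ : 'I_1 => @proj_op G k i)).
  apply: (@Pol_comp _ G 0 k); first exact: isomorphism_Pol.
  by move=> _; exact: Pol_proj.
rewrite /comp_op /unary_op tnth_mktuple /proj_op tnth_map -iE.
by rewrite tnth_map (tnth_nth x) hK.
Qed.

(** The map [f|F |-> xi f b], where [b] generates [G]: it is well defined by
    uniform continuity, onto because [xi] is, and compatible with polymorphisms
    because [xi] preserves composition. *)
Lemma interpretation_nonempty (x0 : G) (y0 : D) : inhabited (pp_interpretation G D).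
Proof.
have [k [b bP]] := oligomorphic_generators x0.
have [F FP] := xi_graph_uniform b.
pose rep (u : (size F).-tuple D) (v : G) := exists f g,
  [/\ @xi_graph k f g, map_tuple f (in_tuple F) = u & g b = v].
apply: (@interpretation_of_rep _ _ _ _ (size F) rep) => //.
- move=> u v v' [f [g [fg fu <-]]] [f' [g' [fg' fu' <-]]].
  apply: FP fg fg' _ => x xF; have xlt : index x F < size F by rewrite index_mem.
  have := congr1 (fun t => tnth t (Ordinal xlt)) (etrans fu (esym fu')).
  by rewrite !tnth_map tnth_index.
- move=> v; have [g /xi_graph_surj[f fg] gv] := bP v.
  by exists (map_tuple f (in_tuple F)), f, g.
- move=> m f hf; have [g fg hg] := xi_graph_dom hf; exists g => // us vs H.
  have /choice[p pP] : forall i, exists p : operation D k * operation G k,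
      [/\ xi_graph p.1 p.2, map_tuple p.1 (in_tuple F) = tnth us i & p.2 b = tnth vs i].
    by move=> i; have [f' [g' H']] := H i; exists (f', g').
  exists (comp_op f (fun i => (p i).1)), (comp_op g (fun i => (p i).2)); split.
  + by apply: xi_graph_comp fg _ => i; have [] := pP i.
  + apply: eq_from_tnth => j; rewrite tnth_map tnth_mktuple; congr f.
    apply: eq_from_tnth => i; rewrite tnth_mktuple tnth_map.
    by have [_ <- _] := pP i; rewrite tnth_map.
  + congr g; apply: eq_from_tnth => i; rewrite tnth_mktuple.
    by have [_ _ <-] := pP i.
Qed.

(** No element needs a representation; only conjuncts without arguments are
    left to translate. *)
Lemma interpretation_source_empty (y0 : D) : ~ (exists x : G, True) ->
  inhabited (pp_interpretation G D).
Proof.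
move=> nG; apply: (@interpretation_of_rep _ _ _ _ 0 (fun _ _ => False)) => //.
- by move=> v; case: nG; exists v.
- by move=> k f /xi_graph_dom[g _ hg]; exists g => // us vs /(_ ord0).
Qed.

(** The two binary projections on the empty set coincide, hence so do those on
    [G], which thus has at most one element. Dimension [0] suffices, and the truth
    of each conjunct can be hard-wired in its gadget. *)
Lemma interpretation_target_empty : ~ (exists y : D, True) ->
  inhabited (pp_interpretation G D).
Proof.
move=> nD.
have G1 (x y : G) : x = y.
  have H1 := xi_graph_proj (ord0 : 'I_2); have := xi_graph_proj (lift ord0 ord0 : 'I_2).
  rewrite (_ : @proj_op D 1 (lift ord0 ord0) = @proj_op D 1 ord0); last first.
    by apply: funext => t; case: nD; exists (tnth t ord0).
  move=> /(xi_graph_fun H1)/(congr1 (fun f => f [tuple x; y])).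
  by rewrite /proj_op.
have tE n (t t' : n.-tuple G) : t = t' by apply: eq_from_tnth.
pose bool_gadget n (P : Prop) : seq (atom tau n) := if `[< P >] then [::] else [:: ABot tau n].
have bool_gadgetP n (e : n.-tuple D) P : all_sat e (bool_gadget n P) <-> P.
  by rewrite /bool_gadget; case: asboolP => H /=; split=> // -[].
have H1 : forall x : G, exists B : 0.-tuple D, True by move=> x; exists [tuple].
have H2 (B : 0.-tuple D) : all_sat (flatten_blocks (fun _ : 'I_1 => B))
    (bool_gadget _ (exists x : G, True)) <-> exists x : G, True.
  exact: bool_gadgetP.
have H3 (a : letter sigma) (Bs : 'I_(letter_arity a) -> 0.-tuple D)
    (xs : (letter_arity a).-tuple G) : (forall i : 'I_(letter_arity a), True) ->
    (letter_holds xs <-> exists C : 0.-tuple D, all_sat (flatten_blocks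
      (fun i : 'I_(letter_arity a).+1 => if unlift ord0 i is Some j then Bs j else C))
      (bool_gadget _ (exists xs : (letter_arity a).-tuple G, letter_holds xs))).
  move=> _; split=> [H|[C /bool_gadgetP[xs' H]]].
    by exists [tuple]; apply/bool_gadgetP; exists xs.
  by rewrite (tE _ xs xs').
exact: inhabits (@PPInterpretation _ _ G D 0 (fun _ _ => True) _ _ H1 H2 H3).
Qed.

Theorem pp_interpretation_exists : inhabited (pp_interpretation G D).
Proof.
have [[y0 _]|nD] := pselect (exists y : D, True); last exact: interpretation_target_empty.
have [[x0 _]|nG] := pselect (exists x : G, True); first exact: interpretation_nonempty.
exact: interpretation_source_empty.
Qed.

End Birkhoff.

(** * The reduction between constraint satisfaction problems *)

Section Atoms.
Variables (sigma : signature) (n : nat).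

Definition atom_letter (a : atom sigma n) : letter sigma :=
  match a with
  | ABot => inr Bottom
  | AEq _ _ => inr Equal
  | ARel R _ => inl R
  end.

Definition atom_args (a : atom sigma n) : (letter_arity (atom_letter a)).-tuple 'I_n :=
  match a with
  | ABot => [tuple]
  | AEq x y => [tuple x; y]
  | ARel R t => t
  end.

Lemma sat_atomE (G : structure sigma) (e : n.-tuple G) (a : atom sigma n) :
  sat_atom e a <-> letter_holds (map_tuple (tnth e) (atom_args a)).
Proof. by case: a => [|x y|R t] //=; rewrite !tnth_map. Qed.

Lemma encode_atomE (a : atom sigma n) :
  encode_atom a = atom_letter a :: flatten [seq encode_var sigma x | x <- atom_args a].
Proof. by case: a => [|x y|R t] //=; rewrite cats0. Qed.

Lemma all_sat_tnth (G : structure sigma) (e : n.-tuple G) (s : seq (atom sigma n)) :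
  all_sat e s <-> forall j, sat_atom e (tnth (in_tuple s) j).
Proof.
rewrite -{1}[s](map_tnth_enum (in_tuple s)) all_sat_map.
by split=> H j; [apply: H; rewrite mem_enum|move=> _; exact: H].
Qed.

End Atoms.

Section Reduction.
Variables (sigma tau : signature) (G : structure sigma) (D : structure tau).
Variable I : pp_interpretation G D.
Let K := dim I.

(** Moves the blocks of a gadget to their positions in the sentence. *)
Definition place b r (c : 'I_r -> 'I_b) (v : 'I_(r * K)) : 'I_(b * K) :=
  block_index (c (block_slot v)) (block_offset v).

Lemma all_sat_place b r (c : 'I_r -> 'I_b) (B : 'I_b -> K.-tuple D) (l : seq (atom tau (r * K))) :
  all_sat (flatten_blocks B) [seq map_atom (place c) a | a <- l] <->
  all_sat (flatten_blocks (B \o c)) l.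
Proof.
rewrite all_sat_map_atom; set e := mktuple _.
suff -> : e = flatten_blocks (B \o c) by [].
by apply: eq_from_tnth => v; rewrite tnth_mktuple tnth_flatten_blocks tnth_mktuple.
Qed.

Variable s : pp_sentence sigma.
Let n := nvars s.
Let m := size (conjuncts s).
Let conjunct (j : 'I_m) : atom sigma n := tnth (in_tuple (conjuncts s)) j.

Definition atom_slots (j : 'I_m) (i : 'I_(letter_arity (atom_letter (conjunct j))).+1) :
    'I_(n + m) :=
  if unlift ord0 i is Some k then lshift m (tnth (atom_args (conjunct j)) k)
  else rshift n j.

(** Block [x < n] represents variable [x], and block [n + j] holds the
    auxiliary variables of conjunct [j]. *)
Definition reduce : pp_sentence tau :=
  @PPSentence tau ((n + m) * K)
    (flatten [seq [seq map_atom (place (fun=> lshift m x)) a | a <- domain_gadget I]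
             | x <- enum 'I_n] ++
     flatten [seq [seq map_atom (place (@atom_slots j)) a
                  | a <- letter_gadget I (atom_letter (conjunct j))]
             | j <- enum 'I_m]).

Lemma reduceP : pp_true G s <-> pp_true D reduce.
Proof.
rewrite /pp_true -/(@all_sat _ _ _); split=> [[e]|[E]].
  move=> /all_sat_tnth es.
  have /choice[B BP] : forall x : 'I_n, exists B, @represents _ _ _ _ I B (tnth e x).
    by move=> x; exact: represented.
  have /choice[C CP] : forall j : 'I_m, exists C, all_sat (flatten_blocks
      (fun i : 'I_(letter_arity (atom_letter (conjunct j))).+1 =>
        if unlift ord0 i is Some k then B (tnth (atom_args (conjunct j)) k) else C))
      (letter_gadget I (atom_letter (conjunct j))).
    move=> j; apply/letter_gadgetP; last exact/sat_atomE/es.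
    by move=> i; rewrite tnth_map; exact: BP.
  pose A (i : 'I_(n + m)) := match fintype.split i with inl x => B x | inr j => C j end.
  have Al x : A (lshift m x) = B x by rewrite /A (unsplitK (inl x : 'I_n + 'I_m)).
  have Ar j : A (rshift n j) = C j by rewrite /A (unsplitK (inr j : 'I_n + 'I_m)).
  exists (flatten_blocks A); rewrite -/(all_sat _ _) all_sat_cat !all_sat_flatten.
  split=> [x _|j _]; apply/all_sat_place.
    rewrite (_ : A \o _ = fun=> B x); last by apply: funext => i /=; rewrite Al.
    by apply/domain_gadgetP; exists (tnth e x).
  congr (all_sat (flatten_blocks _) _): (CP j); apply: funext => i /=.
  by rewrite /atom_slots; case: unlift => [k|]; rewrite ?Al ?Ar.
rewrite -/(all_sat _ _) -[E]blockK all_sat_cat !all_sat_flatten.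
set A := block E; move=> [H1 H2].
have /choice[e eP] : forall x : 'I_n, exists v, @represents _ _ _ _ I (A (lshift m x)) v.
  by move=> x; apply/domain_gadgetP; have /all_sat_place := H1 x (mem_enum _ x).
exists [tuple e x | x < n]; apply/all_sat_tnth => j; apply/sat_atomE.
apply/(letter_gadgetP (Bs := fun k => A (lshift m (tnth (atom_args (conjunct j)) k)))).
  by move=> i; rewrite tnth_map tnth_mktuple; exact: eP.
exists (A (rshift n j)); have /all_sat_place := H2 j (mem_enum _ j).
congr (all_sat (flatten_blocks _) _); apply: funext => i /=.
by rewrite /atom_slots; case: unlift.
Qed.

End Reduction.

(** * Structured programs for Turing machines *)

(** Programs are compiled to state transition functions without any linking
    step: a state of a program is a position in it, and the empty option stands for
    the exit. *)
Section Programs.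
Variables (L : finType) (T : nat).

Definition cells : Type := T.+1.-tuple (option L).
Definition actions : Type := T.+1.-tuple (option L * direction).

Inductive program : Type :=
| Act of cells -> actions
| Seq of program & program
| If of (cells -> bool) & program & program
| While of (cells -> bool) & program.

Fixpoint pstate (p : program) : finType :=
  match p with
  | Act _ => unit
  | Seq p q => (pstate p + pstate q)%type
  | If _ p q => option (pstate p + pstate q)%type
  | While _ p => option (pstate p)
  end.

Fixpoint pstart (p : program) : pstate p :=
  match p with
  | Act _ => tt
  | Seq p q => inl (pstart p)
  | If _ p q => None
  | While _ p => None
  end.

Definition idle (rd : cells) : actions := map_tuple (fun c => (c, Stay)) rd.

Fixpoint pstep (p : program) : pstate p -> cells -> option (pstate p) * actions :=
  match p with
  | Act f => fun _ rd => (None, f rd)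
  | Seq p q => fun x rd =>
      match x with
      | inl y => let: (y', a) := pstep y rd in
          (Some (if y' is Some z then inl z else inr (pstart q)), a)
      | inr y => let: (y', a) := pstep y rd in (omap inr y', a)
      end
  | If t p q => fun x rd =>
      match x with
      | None => (Some (Some (if t rd then inl (pstart p) else inr (pstart q))), idle rd)
      | Some (inl y) => let: (y', a) := pstep y rd in (omap (fun z => Some (inl z)) y', a)
      | Some (inr y) => let: (y', a) := pstep y rd in (omap (fun z => Some (inr z)) y', a)
      end
  | While t p => fun x rd =>
      match x with
      | None => (if t rd then Some (Some (pstart p)) else None, idle rd)
      | Some y => let: (y', a) := pstep y rd in (Some y', a)
      end
  end.

(** Representing the blank rest of a tape explicitly makes tapes with equal
    contents equal; the lists of cells of a concrete tape may differ by
    trailing blanks. *)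
Definition atape : Type := ((nat -> option L) * (nat -> option L))%type.

Definition acons (c : option L) (f : nat -> option L) (i : nat) : option L :=
  if i is j.+1 then f j else c.

Definition abehead (f : nat -> option L) (i : nat) : option L := f i.+1.

Lemma acons_abehead f : acons (f 0) (abehead f) = f.
Proof. by apply: funext; case. Qed.

Definition awrite (t : atape) (a : option L * direction) : atape :=
  let r := acons a.1 (abehead t.2) in
  match a.2 with
  | MoveLeft => (abehead t.1, acons (t.1 0) r)
  | Stay => (t.1, r)
  | MoveRight => (acons a.1 t.1, abehead t.2)
  end.

Definition atapes : Type := 'I_T.+1 -> atape.

Definition reads (s : atapes) : cells := [tuple (s i).2 0 | i < T.+1].

Definition perform (s : atapes) (a : actions) : atapes :=
  fun i => awrite (s i) (tnth a i).

Lemma perform_idle s : perform s (idle (reads s)) = s.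
Proof.
apply: funext => i; rewrite /perform /idle tnth_map tnth_mktuple /awrite /=.
by rewrite acons_abehead; case: (s i).
Qed.

(** The number of steps counts machine transitions, including the one that
    leaves the program. *)
Inductive eval (p : program) : pstate p -> atapes -> nat -> atapes -> Prop :=
| EvalExit x s a : pstep x (reads s) = (None, a) -> eval x s 1 (perform s a)
| EvalStep x y s a n s' : pstep x (reads s) = (Some y, a) ->
    eval y (perform s a) n s' -> eval x s n.+1 s'.

Definition runs (p : program) n s s' := exists2 t, t <= n & eval (pstart p) s t s'.

Lemma runs_leq p m n s s' : m <= n -> runs p m s s' -> runs p n s s'.
Proof. by move=> mn [t tm H]; exists t => //; exact: leq_trans mn. Qed.

Lemma runs_Act f s : runs (Act f) 1 s (perform s (f (reads s))).
Proof. by exists 1 => //; exact: EvalExit. Qed.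

Lemma runs_Seq p q m n s s1 s2 :
  runs p m s s1 -> runs q n s1 s2 -> runs (Seq p q) (m + n) s s2.
Proof.
move=> [t tm Hp] [u un Hq]; exists (t + u); first exact: leq_add.
have {}Hq : @eval (Seq p q) (inr (pstart q)) s1 u s2.
  elim: {un Hp} Hq => {u s1 s2} [x s1 a E|x y s1 a u s2 E _ IH].
    by apply: EvalExit; rewrite /= E.
  by apply: EvalStep IH; rewrite /= E.
rewrite [pstart _]/=.
elim: {tm} Hp Hq => {t s s1} [x s a E Hq|x y s a t s1 E _ IH /IH H].
  by apply: EvalStep Hq; rewrite /= E.
by apply: EvalStep H; rewrite /= E.
Qed.

Lemma runs_If (t : cells -> bool) p q n s s' :
  runs (if t (reads s) then p else q) n s s' -> runs (If t p q) n.+1 s s'.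
Proof.
move=> [u un H]; exists u.+1 => //; apply: (@EvalStep (If t p q)); first by [].
rewrite perform_idle; case: (t _) H => H.
  elim: {un} H => {u s s'} [x s a E|x y s a u s' E _ IH].
    by apply: EvalExit; rewrite /= E.
  by apply: EvalStep IH; rewrite /= E.
elim: {un} H => {u s s'} [x s a E|x y s a u s' E _ IH].
  by apply: EvalExit; rewrite /= E.
by apply: EvalStep IH; rewrite /= E.
Qed.

Lemma runs_While_end (t : cells -> bool) p s : ~~ t (reads s) -> runs (While t p) 1 s s.
Proof.
move=> /negbTE ts; exists 1 => //; rewrite -[X in eval _ _ _ X]perform_idle.
by apply: EvalExit; rewrite /= ts.
Qed.

Lemma runs_While_step (t : cells -> bool) p m n s s1 s2 : t (reads s) ->
  runs p m s s1 -> runs (While t p) n s1 s2 -> runs (While t p) (m + n).+1 s s2.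
Proof.
move=> ts [u um Hp] [w wn Hw]; exists (u + w).+1; first by rewrite ltnS leq_add.
apply: (@EvalStep (While t p)); first by rewrite /= ts.
rewrite perform_idle.
elim: {um ts} Hp Hw => {u s s1} [x s a E Hw|x y s a u s1 E _ IH /IH H].
  by apply: EvalStep Hw; rewrite /= E.
by apply: EvalStep H; rewrite /= E.
Qed.

Section Machine.
Variables (I O : finType) (inp : I -> L) (out : O -> L).
Hypotheses (inp_inj : injective inp) (out_inj : injective out).

Definition program_machine (p : program) : machine I O :=
  @Machine I O (option (pstate p)) L T inp out inp_inj out_inj
    (Some (pstart p)) (fun q => q == None)
    (fun q rd => if q is Some x then pstep x rd else (None, idle rd)).

Definition view (t : tape L) : atape := (nth None (left_cells t), nth None (right_cells t)).

Lemma nth_cons (c : option L) s : nth None (c :: s) = acons c (nth None s).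
Proof. by apply: funext; case. Qed.

Lemma nth_behead (s : seq (option L)) : nth None (behead s) = abehead (nth None s).
Proof. by apply: funext => i; rewrite nth_behead. Qed.

Lemma nth_head (s : seq (option L)) : head None s = nth None s 0.
Proof. by case: s. Qed.

Lemma view_write_move t a : view (write_move t a) = awrite (view t) a.
Proof.
by case: a => c [] /=; rewrite /view /awrite /= ?nth_cons ?nth_behead ?nth_head.
Qed.

Definition input_tapes (w : seq I) : atapes := fun i =>
  (fun=> None, if i == ord0 then nth None [seq Some (inp a) | a <- w] else fun=> None).

(** One step of the machine on concrete tapes is one step of the program on the
    tapes they represent. Once the exit is reached the machine halts, so the
    bound [n] need not be attained. *)
Lemma program_computes p n w v s : runs p n (input_tapes w) s ->
  (s ord_max).2 = nth None [seq Some (out b) | b <- v] ->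
  computes_within (program_machine p) n w v.
Proof.
move=> [t tn H] sv; set M := program_machine p.
have stepP (x : pstate p) (c : (tapes M).+1.-tuple (tape L)) :
    let s := fun i => view (tnth c i) in let xa := pstep x (reads s) in
    exists c', @step I O M (Some x, c) = (xa.1, c') /\
      (fun i => view (tnth c' i)) = perform s xa.2.
  move=> /=; rewrite /step /=.
  have -> : map_tuple (@read _) c = reads (fun i => view (tnth c i)).
    by apply: eq_from_tnth => i; rewrite tnth_map tnth_mktuple /read nth_head.
  eexists; split; first by [].
  by apply: funext => i; rewrite tnth_mktuple view_write_move.
have main x s0 u s1 : eval x s0 u s1 -> forall c : (tapes M).+1.-tuple (tape L),
    (fun i => view (tnth c i)) = s0 ->
    exists c' : (tapes M).+1.-tuple (tape L), iter u (@step I O M) (Some x, c) = (None, c') /\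
      (fun i => view (tnth c' i)) = s1.
  elim=> {x s0 u s1} [x s0 a E|x y s0 a u s1 E _ IH] c cs.
    by have := stepP x c; rewrite /= cs E => -[c' [H1 H2]]; exists c'.
  have := stepP x c; rewrite /= cs E => -[c' [H1 H2]].
  have [c'' [H3 H4]] := IH c' H2; exists c''; split=> //.
  by rewrite -iterS iterSr H1.
pose c0 : (tapes M).+1.-tuple (tape L) := (initial M w).2.
have [|c [cE cs]] := main _ _ _ _ H c0.
  apply: funext => i; rewrite /c0 /= tnth_mktuple /view /input_tapes /=.
  by congr pair; [|case: ifP] => *; apply: funext => -[].
rewrite /computes_within.
have -> : iter n (@step I O M) (initial M w) = (None, c).
  rewrite -(subnK tn) iterD.
  have -> : initial M w = (Some (pstart p), c0) by [].
  rewrite cE; elim: (n - t) => //= k ->; by rewrite /step.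
split=> //; rewrite /has_output /=.
have {}sv : nth None (right_cells (tnth c ord_max)) = nth None [seq Some (out b) | b <- v].
  by rewrite -sv -cs.
move: (right_cells _) sv => r sv {c cE cs}; exists (size r - size v).
have sv' j : nth None r j = nth None [seq Some (out b) | b <- v] j by rewrite sv.
have vr : size v <= size r.
  case/lastP: v sv' {sv H} => // v b /(_ (size v)).
  rewrite map_rcons nth_rcons size_map ltnn eqxx size_rcons ltnNge => rE.
  by apply: contra_eqN rE => /(nth_default None) ->.
apply: (@eq_from_nth _ None).
  by rewrite size_cat size_map size_nseq subnKC.
move=> j _; rewrite sv' nth_cat size_map nth_nseq if_same.
by case: ltnP => // ?; rewrite nth_default// size_map.
Qed.

End Machine.
End Programs.

(** * Programs with counters *)

(** Tape [0] is the input, which is erased while it is read; tape [T.+1] is the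
    output; the tapes between them are counters. *)
Section CounterPrograms.
Variables (I O : finType) (mk : I) (T : nat).
Let L : finType := (I + O)%type.
Notation program := (program L T.+1).
Notation atapes := (atapes L T.+1).
Notation atape := (atape L).

Definition blank : nat -> option L := fun=> None.

(** The value of a counter is the distance of the head from a marked cell. So
    incrementing, decrementing and testing for zero take one step each. *)
Definition counter_tape (x : nat) : atape :=
  (fun i => if i.+1 == x then Some (inl mk) else None,
   fun i => if (x == 0) && (i == 0) then Some (inl mk) else None).

Definition out_cells (v : seq O) : seq (option L) := [seq Some (inr b) | b <- v].

(** [out_end] has the head behind the written word, [out_start] on the blank cell
    in front of it. *)
Definition out_end (v : seq O) : atape := (nth None (rev (out_cells v)), blank).

Definition out_start (v : seq O) : atape := (blank, acons None (nth None (out_cells v))).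

Definition in_tape (w : seq I) : atape := (blank, nth None [seq Some (inl a) | a <- w]).

Definition layout (w : seq I) (c : nat -> nat) (o : atape) : atapes := fun i =>
  if i == 0 :> nat then in_tape w
  else if i == T.+1 :> nat then o else counter_tape (c i).

Lemma layout_counter w c o (i : 'I_T.+2) : 0 < i <= T -> layout w c o i = counter_tape (c i).
Proof.
move=> /andP[i0 iT]; rewrite /layout gtn_eqF// eqn_leq [T < i]ltnNge iT andbF.
by [].
Qed.

Definition on (q : nat) (f : option L -> option L * direction) : program :=
  Act (fun rd => [tuple if i == q :> nat then f (tnth rd i) else (tnth rd i, Stay) | i < T.+2]).

Lemma runs_on q f (s s' : atapes) :
  (forall i, s' i = if i == q :> nat then awrite (s i) (f ((s i).2 0)) else s i) ->
  runs (on q f) 1 s s'.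
Proof.
move=> sE; rewrite (_ : s' = perform s [tuple if i == q :> nat then f (tnth (reads s) i)
  else (tnth (reads s) i, Stay) | i < T.+2]); first exact: runs_Act.
apply: funext => i; rewrite sE /perform !tnth_mktuple; case: eqP => // _.
by rewrite /awrite /= acons_abehead; case: (s i).
Qed.

Definition skip : program := Act (@idle L T.+1).

Lemma runs_skip s : runs skip 1 s s.
Proof. by rewrite -[X in runs _ _ _ X]perform_idle; exact: runs_Act. Qed.

Definition seqs (ps : seq program) : program := foldr (@Seq L T.+1) skip ps.

Definition upd (c : nat -> nat) q x : nat -> nat := fun i => if i == q then x else c i.

Definition advance : program := on 0 (fun=> (None, MoveRight)).
Definition inc q : program := on q (fun a => (a, MoveRight)).
Definition dec q : program := on q (fun a => (a, MoveLeft)).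
Definition put b : program := on T.+1 (fun=> (Some (inr b), MoveRight)).
Definition put_left b : program := on T.+1 (fun=> (Some (inr b), MoveLeft)).

Definition head_is (P : pred I) (rd : cells L T.+1) : bool :=
  if tnth rd ord0 is Some (inl a) then P a else false.
Definition pos q (rd : cells L T.+1) : bool := ~~ tnth rd (inord q).

Lemma blank_acons : acons None blank = blank.
Proof. by apply: funext; case. Qed.

Lemma runs_advance a w c o : runs advance 1 (layout (a :: w) c o) (layout w c o).
Proof.
apply: runs_on => i; rewrite /layout; case: ifP => // _.
by rewrite /awrite /= blank_acons.
Qed.

Lemma runs_inc q w c o : 0 < q <= T -> runs (inc q) 1 (layout w c o) (layout w (upd c q (c q).+1) o).
Proof.
move=> qT; apply: runs_on => i; case: eqP => [iq|/eqP iq]; last first.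
  by rewrite /layout /upd (negbTE iq).
rewrite !layout_counter ?iq// /upd eqxx /awrite /counter_tape /=.
congr pair; apply: funext => j; last by rewrite /abehead /= ?andbF.
by case: j => [|j] /=; rewrite eqSS ?andbT// eq_sym.
Qed.

Lemma runs_dec q x w c o : 0 < q <= T -> c q = x.+1 ->
  runs (dec q) 1 (layout w c o) (layout w (upd c q x) o).
Proof.
move=> qT cq; apply: runs_on => i; case: eqP => [iq|/eqP iq]; last first.
  by rewrite /layout /upd (negbTE iq).
rewrite !layout_counter ?iq// /upd eqxx /awrite /counter_tape /= cq.
congr pair; apply: funext => j.
by case: j => [|[|j]] /=; rewrite /abehead ?andbF ?andbT // eqSS eq_sym.
Qed.

Lemma runs_out f w c o :
  runs (on T.+1 f) 1 (layout w c o) (layout w c (awrite o (f (o.2 0)))).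
Proof.
apply: runs_on => i; case: eqP => [iT|/eqP iT].
  by rewrite /layout iT eqxx.
by rewrite /layout (negbTE iT).
Qed.

Lemma runs_put b w c v : runs (put b) 1 (layout w c (out_end v)) (layout w c (out_end (rcons v b))).
Proof.
have := runs_out (fun=> (Some (inr b), MoveRight)) w c (out_end v).
by rewrite /awrite /out_end /out_cells /= map_rcons rev_rcons nth_cons.
Qed.

Lemma runs_put_left b w c v :
  runs (put_left b) 1 (layout w c (out_start v)) (layout w c (out_start (b :: v))).
Proof.
have := runs_out (fun=> (Some (inr b), MoveLeft)) w c (out_start v).
by rewrite /awrite /out_start /out_cells /= nth_cons.
Qed.

Lemma head_is_layout P w c o :
  head_is P (reads (layout w c o)) = if w is a :: _ then P a else false.
Proof. by rewrite /head_is tnth_mktuple /layout /=; case: w. Qed.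

Lemma pos_layout q w c o : 0 < q <= T -> pos q (reads (layout w c o)) = (c q != 0).
Proof.
move=> qT; have qT2 : q < T.+2 by lia.
rewrite /pos tnth_mktuple layout_counter inordK// /counter_tape /=.
by case: (c q).
Qed.

Lemma updK c q x : c q = x -> upd c q x = c.
Proof. by move=> <-; apply: funext => i; rewrite /upd; case: eqP => [->|]. Qed.

Lemma upd_upd c q x y : upd (upd c q x) q y = upd c q y.
Proof. by apply: funext => i; rewrite /upd; case: eqP. Qed.

Lemma upd_same c q x : upd c q x q = x.
Proof. by rewrite /upd eqxx. Qed.

Lemma upd_neq c q r x : r != q -> upd c q x r = c r.
Proof. by rewrite /upd => /negbTE->. Qed.

Definition puts (u : seq O) : program := seqs [seq put b | b <- u].

Lemma runs_puts u w c v :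
  runs (puts u) (size u).+1 (layout w c (out_end v)) (layout w c (out_end (v ++ u))).
Proof.
elim: u v => [|b u IH] v; first by rewrite cats0; exact: runs_skip.
rewrite -cat_rcons; apply: (@runs_Seq _ _ _ _ 1 (size u).+1 _ _ _ _ (IH _)); exact: runs_put.
Qed.

Definition clear q : program := While (pos q) (dec q).

Lemma runs_clear q w c o : 0 < q <= T ->
  runs (clear q) (2 * c q).+1 (layout w c o) (layout w (upd c q 0) o).
Proof.
move=> qT; move cx : (c q) => x; elim: x c cx => [|x IH] c cx.
  by rewrite updK//; apply: runs_While_end; rewrite pos_layout// cx.
apply: (@runs_leq _ _ _ (1 + (2 * x).+1).+1); first lia.
apply: runs_While_step; first by rewrite pos_layout// cx.
  exact: runs_dec cx.
by rewrite -(upd_upd c q x 0); apply: IH; rewrite upd_same.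
Qed.

Definition rewind : program :=
  Seq (on T.+1 (fun a => (a, MoveLeft)))
    (While (fun rd => isSome (tnth rd ord_max)) (on T.+1 (fun a => (a, MoveLeft)))).

(** The tape while the head moves back over the written word: it is on the last
    letter of [u], and [x] is to the right of it. *)
Definition out_mid (u x : seq O) : atape :=
  (abehead (nth None (rev (out_cells u))),
   acons (nth None (rev (out_cells u)) 0) (nth None (out_cells x))).

Lemma runs_rewind w c v :
  runs rewind (2 * size v).+2 (layout w c (out_end v)) (layout w c (out_start v)).
Proof.
have -> : (2 * size v).+2 = 1 + (2 * size v).+1 by [].
apply: (@runs_Seq _ _ _ _ _ _ _ (layout w c (out_mid v [::]))).
  have := runs_out (fun a => (a, MoveLeft)) w c (out_end v).
  rewrite /awrite /= acons_abehead /out_mid /out_end /=.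
  by rewrite (_ : nth None [::] = blank)//; apply: funext; case.
rewrite -[in out_start v](cats0 v); elim/last_ind: v [::] => [|v b IH] x.
  rewrite cat0s (_ : out_mid [::] x = out_start x).
    by apply: runs_While_end; rewrite tnth_mktuple /layout /= eqxx.
  by rewrite /out_mid /out_start; congr pair; apply: funext; case.
rewrite size_rcons cat_rcons.
apply: (@runs_leq _ _ _ (1 + (2 * size v).+1).+1); first lia.
apply: runs_While_step (IH (b :: x)).
  by rewrite tnth_mktuple /layout /= eqxx /out_mid /out_cells map_rcons rev_rcons.
have := runs_out (fun a => (a, MoveLeft)) w c (out_mid (rcons v b) x).
by rewrite /awrite /out_mid /out_cells map_rcons rev_rcons !nth_cons.
Qed.

End CounterPrograms.

(** * Scanning a sentence and writing its translation *)

Ltac upd_eq := apply: funext => ?; rewrite /upd; repeat (case: eqP => ?); subst; lia.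

(** Counter [1] holds the number of the block in use, counter [2] is scratch
    space, and counter [i + 3] holds the name of argument [i]. *)
Section ReductionProgram.
Variables (sigma tau : signature) (K : nat).
Variable delta : seq (atom tau (1 * K)).
Variable gadget : forall a : letter sigma, seq (atom tau ((letter_arity a).+1 * K)).

Let mk : letter sigma := inr Stroke.
Definition max_arity := \max_(a : letter sigma) letter_arity a.
Let T := max_arity.+2.
Let L : finType := (letter sigma + letter tau)%type.
Local Notation program := (program L T.+1).
Local Notation conf w c v := (@layout (letter sigma) (letter tau) mk T w c (out_end (letter sigma) v)).
Local Notation skip := (@skip (letter sigma) (letter tau) T).
Local Notation seqs := (@seqs (letter sigma) (letter tau) T).
Local Notation put := (@put (letter sigma) (letter tau) T).
Local Notation puts := (@puts (letter sigma) (letter tau) T).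
Local Notation inc := (@inc (letter sigma) (letter tau) T).
Local Notation dec := (@dec (letter sigma) (letter tau) T).
Local Notation pos := (@pos (letter sigma) (letter tau) T).
Local Notation advance := (@advance (letter sigma) (letter tau) T).
Local Notation head_is := (@head_is (letter sigma) (letter tau) T).
Local Notation clear := (@clear (letter sigma) (letter tau) T).

Definition output_name x : seq (letter tau) := rcons (nseq x (inr Stroke)) (inr EndVar).

(** Multiplying by [K] empties the counter, whose value is saved in counter [2]
    and copied back. *)
Definition emit_name q o : program :=
  Seq (While (pos q) (Seq (dec q) (Seq (inc 2) (puts (nseq K (inr Stroke))))))
    (Seq (While (pos 2) (Seq (dec 2) (inc q))) (puts (output_name o))).

Lemma runs_emit_name q o w c v : 2 < q <= T \/ q = 1 -> c 2 = 0 ->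
  runs (emit_name q o) ((K + 7) * c q + o + 4)
    (conf w c v) (conf w c (v ++ output_name (c q * K + o))).
Proof.
move=> qT c2; have q2 : q != 2 by lia.
have {}qT : 0 < q <= T by rewrite /T in qT *; lia.
have T2 : 0 < 2 <= T by [].
have loop1 x : forall c v, c q = x ->
    runs (While (pos q) (Seq (dec q) (Seq (inc 2) (puts (nseq K (inr Stroke))))))
      ((K + 4) * x + 1) (conf w c v)
      (conf w (upd (upd c 2 (c 2 + x)) q 0) (v ++ nseq (x * K) (inr Stroke))).
  elim: x => [|x IH] c' v' cq.
    rewrite muln0 add0n cats0 (_ : upd _ _ _ = c'); last by upd_eq.
    by apply: runs_While_end; rewrite pos_layout// cq.
  apply: (@runs_leq _ _ _ ((1 + (1 + K.+1)) + ((K + 4) * x + 1)).+1); first lia.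
  pose c1 := upd (upd c' q x) 2 (c' 2).+1.
  apply: runs_While_step; first by rewrite pos_layout// cq.
    apply: runs_Seq; first exact: runs_dec cq.
    apply: runs_Seq; first exact: runs_inc.
    rewrite [upd c' q x 2]upd_neq 1?eq_sym// -/c1.
    have := runs_puts mk T (nseq K (inr Stroke : letter tau)) w c1 v'.
    by rewrite size_nseq; exact.
  have := IH c1 (v' ++ nseq K (inr Stroke)).
  rewrite {1}/c1 upd_neq // upd_same => /(_ erefl).
  rewrite -catA -nseqD -mulSn.
  rewrite (_ : upd (upd c1 2 (c1 2 + x)) q 0 = upd (upd c' 2 (c' 2 + x.+1)) q 0) //.
  by rewrite /c1; upd_eq.
have loop2 x : forall c v, c 2 = x ->
    runs (While (pos 2) (Seq (dec 2) (inc q))) (3 * x + 1) (conf w c v)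
      (conf w (upd (upd c q (c q + x)) 2 0) v).
  elim: x => [|x IH] c' v' cq.
    rewrite (_ : upd _ _ _ = c'); last by upd_eq.
    by apply: runs_While_end; rewrite pos_layout// cq.
  apply: (@runs_leq _ _ _ ((1 + 1) + (3 * x + 1)).+1); first lia.
  pose c1 := upd (upd c' 2 x) q (c' q).+1.
  apply: runs_While_step; first by rewrite pos_layout// cq.
    apply: runs_Seq; first exact: runs_dec cq.
    have := @runs_inc _ (letter tau) mk T q w (upd c' 2 x) (out_end _ v') qT.
    by rewrite [upd c' 2 x q]upd_neq; [exact|].
  have := IH c1 v'.
  rewrite {1}/c1 upd_neq 1?eq_sym // upd_same => /(_ erefl).
  rewrite (_ : upd (upd c1 q (c1 q + x)) 2 0 = upd (upd c' q (c' q + x.+1)) 2 0) //.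
  by rewrite /c1; upd_eq.
apply: (@runs_leq _ _ _ (((K + 4) * c q + 1) + ((3 * c q + 1) + o.+2))); first lia.
apply: runs_Seq; first exact: loop1.
pose c1 := upd (upd c 2 (c 2 + c q)) q 0.
apply: (@runs_Seq _ _ _ _ _ _ _ (conf w (upd (upd c1 q (c1 q + c q)) 2 0)
  (v ++ nseq (c q * K) (inr Stroke)))).
  by apply: loop2; rewrite /c1 upd_neq ?upd_same ?c2// eq_sym.
rewrite (_ : upd _ _ _ = c); last by rewrite /c1; upd_eq.
have := runs_puts mk T (output_name o) w c (v ++ nseq (c q * K) (inr Stroke)).
rewrite /output_name size_rcons size_nseq -catA -rcons_cat -nseqD; exact.
Qed.

(** The counter with the position of block [i] of a gadget: block [0] is the
    block in use, the others are those of the arguments. *)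
Definition slot_counter (i : nat) : nat := if i is j.+1 then j + 3 else 1.

Definition emit_var (v : nat) : program := emit_name (slot_counter (v %/ K)) (v %% K).

Definition emit_atom b (a : atom tau b) : program :=
  Seq (put (atom_letter a)) (seqs [seq emit_var (v : 'I_b) | v <- atom_args a]).

Definition emit_gadget b (l : seq (atom tau b)) : program := seqs [seq emit_atom a | a <- l].

Definition var_word (c : nat -> nat) (v : nat) : seq (letter tau) :=
  output_name (c (slot_counter (v %/ K)) * K + v %% K).

Definition atom_word c b (a : atom tau b) : seq (letter tau) :=
  atom_letter a :: flatten [seq var_word c (v : 'I_b) | v <- atom_args a].

Definition gadget_word c b (l : seq (atom tau b)) : seq (letter tau) :=
  flatten [seq atom_word c a | a <- l].

Lemma runs_seqs_emit (X : Type) (p : X -> program) (f : X -> seq (letter tau)) n w c :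
  (forall x v, runs (p x) n (conf w c v) (conf w c (v ++ f x))) -> forall xs v,
  runs (seqs [seq p x | x <- xs]) (size xs * n).+1 (conf w c v)
    (conf w c (v ++ flatten [seq f x | x <- xs])).
Proof.
move=> H; elim=> [|x xs IH] v; first by rewrite cats0; exact: runs_skip.
apply: (@runs_leq _ _ _ (n + (size xs * n).+1)); first by rewrite /=; lia.
by rewrite /= catA; apply: runs_Seq (H x v) (IH _).
Qed.

Lemma size_flatten_leq (X : Type) (f : X -> seq (letter tau)) n xs :
  (forall x, size (f x) <= n) -> size (flatten [seq f x | x <- xs]) <= size xs * n.
Proof.
by move=> H; elim: xs => //= x xs IH; rewrite size_cat mulSn leq_add.
Qed.

(** The gadget is a constant of the program, so the time is linear in the largest
    counter value. The length of the output is bounded as well because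
    the output has to be rewound at the end. *)
Lemma runs_emit_gadget r (l : seq (atom tau (r.+1 * K))) : r <= max_arity ->
  exists C, forall U c, (forall q, c q <= U) -> c 2 = 0 ->
    size (gadget_word c l) <= C * U.+1 /\
    forall w v, runs (emit_gadget l) (C * U.+1) (conf w c v) (conf w c (v ++ gadget_word c l)).
Proof.
move=> rT.
elim: l => [|a l [C IH]].
  exists 1 => U c cU c2; split=> // w v; rewrite cats0.
  by apply: runs_leq (runs_skip _); rewrite mul1n.
pose B := 2 * K + 12; pose m := size (atom_args a).
exists (m * B + 2 + C) => U c cU c2; have {IH}[IH1 IH2] := IH U c cU c2.
have oK (x : 'I_(r.+1 * K)) : x %% K < K := block_offset_subproof x.
split=> [|w v].
  apply: (@leq_trans (1 + m * (B * U.+1) + C * U.+1)); last nia.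
  rewrite (_ : gadget_word c (a :: l) = atom_word c a ++ gadget_word c l) // size_cat.
  apply: leq_add => //; rewrite add1n ltnS; apply: size_flatten_leq => x.
  rewrite /var_word /output_name size_rcons size_nseq.
  have := cU (slot_counter (x %/ K)); have := oK x; rewrite /B; nia.
apply: (@runs_leq _ _ _ ((1 + (m * (B * U.+1)).+1) + C * U.+1)); first nia.
rewrite (_ : v ++ gadget_word c (a :: l) = (rcons v (atom_letter a) ++
  flatten [seq var_word c (x : 'I_(r.+1 * K)) | x <- atom_args a]) ++ gadget_word c l); last first.
  by rewrite -cats1 -!catA.
apply: runs_Seq; last exact: IH2.
apply: runs_Seq; first exact: runs_put.
apply: runs_seqs_emit => x u.
apply: runs_leq; last apply: runs_emit_name => //.
  by have := cU (slot_counter (x %/ K)); have := oK x; rewrite /B; nia.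
have := block_slot_subproof x; rewrite /slot_counter /T.
by case: (x %/ K) => [|j]; [right|left; lia].
Qed.

Definition parse q : program := Seq (While (head_is (pred1 mk)) (Seq advance (inc q))) advance.

Definition input_name x : seq (letter sigma) := rcons (nseq x (inr Stroke)) (inr EndVar).

Lemma runs_parse q x w c v : 0 < q <= T -> runs (parse q) (3 * x + 2)
  (conf (input_name x ++ w) c v) (conf w (upd c q (c q + x)) v).
Proof.
move=> qT; have -> : 3 * x + 2 = (3 * x + 1) + 1 by lia.
apply: (@runs_Seq _ _ _ _ _ _ _ (conf (inr EndVar :: w) (upd c q (c q + x)) v)); last exact: runs_advance.
elim: x c => [|x IH] c.
  rewrite addn0 updK//; apply: runs_While_end.
  by rewrite head_is_layout; apply/eqP.
apply: (@runs_leq _ _ _ ((1 + 1) + (3 * x + 1)).+1); first lia.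
apply: runs_While_step.
- by rewrite head_is_layout /= eqxx.
- by apply: runs_Seq; [exact: runs_advance|exact: runs_inc].
- have := IH (upd c q (c q).+1); rewrite upd_same upd_upd addSnnS; exact.
Qed.

Definition load (c : nat -> nat) s (xs : seq nat) : nat -> nat := fun q =>
  if s + 3 <= q < s + 3 + size xs then nth 0 xs (q - (s + 3)) else c q.

Lemma runs_parses U s (xs : seq nat) w c v : s + size xs <= max_arity ->
  (forall q, s + 3 <= q -> c q = 0) -> (forall x, x \in xs -> x <= U) ->
  runs (seqs [seq parse (i + 3) | i <- iota s (size xs)]) (size xs * (3 * U + 2)).+1
    (conf (flatten [seq input_name x | x <- xs] ++ w) c v) (conf w (load c s xs) v).
Proof.
elim: xs s c => [|x xs IH] s c sT c0 xU.
  rewrite (_ : load c s [::] = c); first exact: runs_skip.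
  by apply: funext => q; rewrite /load /=; case: ifP => //; lia.
apply: (@runs_leq _ _ _ ((3 * x + 2) + (size xs * (3 * U + 2)).+1)).
  by have := xU x (mem_head _ _); rewrite /=; nia.
rewrite /= -catA; apply: runs_Seq; first by apply: runs_parse; rewrite /T /= in sT *; lia.
rewrite (_ : load c s (x :: xs) = load (upd c (s + 3) (c (s + 3) + x)) s.+1 xs).
  apply: IH => [|q sq|y ys]; first by move: sT => /=; lia.
    by rewrite upd_neq ?c0//; lia.
  by apply: xU; rewrite inE ys orbT.
apply: funext => q; rewrite /load /upd /=; have [->|qs] := eqVneq q (s + 3).
  rewrite ifT ?[X in _ = X]ifF; [|lia|lia]; by rewrite subnn c0.
case: ifP => H; case: ifP => H' //; [|lia|lia].
by rewrite (_ : q - (s + 3) = (q - (s.+1 + 3)).+1)//; lia.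
Qed.

Lemma runs_clears U s r w c v : s + r <= max_arity -> (forall q, c q <= U) ->
  runs (seqs [seq clear (i + 3) | i <- iota s r]) (r * (2 * U + 1)).+1 (conf w c v)
    (conf w (fun q => if s + 3 <= q < s + 3 + r then 0 else c q) v).
Proof.
elim: r s c => [|r IH] s c sT cU.
  rewrite (_ : (fun q => if s + 3 <= q < s + 3 + 0 then 0 else c q) = c); first exact: runs_skip.
  by apply: funext => q; case: ifP => //; lia.
apply: (@runs_leq _ _ _ ((2 * c (s + 3)).+1 + (r * (2 * U + 1)).+1)).
  by have := cU (s + 3); nia.
rewrite /=; apply: runs_Seq; first by apply: runs_clear; rewrite /T; lia.
rewrite (_ : (fun q => if s + 3 <= q < s + 3 + r.+1 then 0 else c q) =
  fun q => if s.+1 + 3 <= q < s.+1 + 3 + r then 0 else upd c (s + 3) 0 q); last first.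
  apply: funext => q; rewrite /upd; have [->|qs] := eqVneq q (s + 3).
    by rewrite ifT ?if_same//; lia.
  by case: ifP => H; case: ifP => H' //; lia.
apply: IH => [|q]; first lia.
by rewrite /upd; case: ifP.
Qed.

(** The counters between two conjuncts. *)
Definition base t : nat -> nat := fun q => if q == 1 then t else 0.

(** Incrementing counter [1] at the end reserves a fresh block for each
    conjunct. *)
Definition handle (a : letter sigma) : program :=
  Seq advance (Seq (seqs [seq parse (i + 3) | i <- iota 0 (letter_arity a)])
    (Seq (emit_gadget (gadget a))
      (Seq (seqs [seq clear (i + 3) | i <- iota 0 (letter_arity a)]) (inc 1)))).

Lemma letter_arity_max (a : letter sigma) : letter_arity a <= max_arity.
Proof. exact: (leq_bigmax (F := @letter_arity sigma)). Qed.

Lemma runs_handle (a : letter sigma) : exists C, forall U t (xs : seq nat), size xs = letter_arity a ->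
  t <= U -> (forall x, x \in xs -> x <= U) ->
  size (gadget_word (load (base t) 0 xs) (gadget a)) <= C * U.+1 /\
  forall w v, runs (handle a) (C * U.+1)
    (conf (a :: flatten [seq input_name x | x <- xs] ++ w) (base t) v)
    (conf w (base t.+1) (v ++ gadget_word (load (base t) 0 xs) (gadget a))).
Proof.
have [C CP] := runs_emit_gadget (gadget a) (letter_arity_max a).
exists (C + 4 + letter_arity a * 5) => U t xs sxs tU xU.
have lU q : load (base t) 0 xs q <= U.
  rewrite /load /base; case: ifP => [H|_]; last by case: ifP.
  have qx : q - (0 + 3) < size xs by lia.
  exact/xU/mem_nth.
have [|CP1 CP2] := CP U _ lU; first by [].
split=> [|w v]; first by apply: leq_trans CP1 _; nia.
apply: (@runs_leq _ _ _ (1 + ((size xs * (3 * U + 2)).+1 + (C * U.+1 +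
  ((letter_arity a * (2 * U + 1)).+1 + 1))))); first by rewrite sxs; nia.
apply: runs_Seq; first exact: runs_advance.
apply: runs_Seq.
  rewrite -sxs; apply: runs_parses => [|q|//]; first by rewrite add0n sxs letter_arity_max.
  by rewrite /base; case: eqP => // ->.
apply: runs_Seq; first exact: CP2.
apply: runs_Seq; first by apply: runs_clears lU; rewrite letter_arity_max.
rewrite (_ : (fun q => if 0 + 3 <= q < 0 + 3 + letter_arity a then 0 else load (base t) 0 xs q) =
  base t); last first.
  apply: funext => q; rewrite /load sxs /base.
  by case: ifP => // H; rewrite ifF//; lia.
have := @runs_inc _ (letter tau) mk T 1 w (base t)
  (out_end _ (v ++ gadget_word (load (base t) 0 xs) (gadget a))) isT.
by rewrite (_ : upd (base t) 1 _ = base t.+1)//; apply: funext => q; rewrite /upd /base; case: eqP.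
Qed.

Definition dispatch : program :=
  foldr (fun a p => If (head_is (pred1 a)) (handle a) p) skip (enum (letter sigma)).

Lemma runs_dispatch a n w c v s : runs (handle a) n (conf (a :: w) c v) s ->
  runs dispatch (n + #|letter sigma|) (conf (a :: w) c v) s.
Proof.
move=> H; rewrite /dispatch cardE.
have : a \in enum (letter sigma) by rewrite mem_enum.
elim: (enum _) => //= b l IH; rewrite inE => al; rewrite addnS; apply: runs_If.
rewrite head_is_layout /=; case: eqVneq al => [<- _|_ /= /IH//].
by apply: runs_leq H; rewrite leq_addr.
Qed.

Fixpoint conjunct_words n t (cs : seq (atom sigma n)) : seq (letter tau) :=
  if cs is a :: cs' then
    gadget_word (load (base t) 0 [seq val x | x <- atom_args a]) (gadget (atom_letter a)) ++
    conjunct_words t.+1 cs'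
  else [::].

Definition conjunct_loop : program := While (head_is predT) dispatch.

Lemma runs_conjunct_loop : exists C, forall U n (cs : seq (atom sigma n)) t,
  n <= U -> t + size cs <= U ->
  size (conjunct_words t cs) <= size cs * (C * U.+1) /\
  forall v, runs conjunct_loop (size cs * (C * U.+1)).+1
    (conf (flatten [seq encode_atom a | a <- cs]) (base t) v)
    (conf [::] (base (t + size cs)) (v ++ conjunct_words t cs)).
Proof.
pose C a := projT1 (cid (runs_handle a)); have CP a := projT2 (cid (runs_handle a)).
exists (\sum_a C a + #|letter sigma| + 1) => U n cs + nU; set B := _ + _ + 1.
elim: cs => [|a cs IH] t tU.
  split=> // v; rewrite addn0 cats0; apply: runs_While_end.
  by rewrite head_is_layout.
have CB : C (atom_letter a) + #|letter sigma| + 1 <= B.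
  by rewrite /B !leq_add2r (bigD1 (atom_letter a)) //= leq_addr.
have [|IH1 IH2] := IH t.+1; first by move: tU => /=; lia.
have [|||H1 H2] := CP (atom_letter a) U t [seq val x | x <- atom_args a].
- by rewrite size_map size_tuple.
- by move: tU => /=; lia.
- by move=> _ /mapP[x _ ->]; apply: leq_trans (ltnW (ltn_ord x)) nU.
rewrite -/(C _) in H1 H2; split=> [|v].
  rewrite /= size_cat [X in _ <= X]mulSn; apply: leq_add IH1; apply: leq_trans H1 _; nia.
apply: (@runs_leq _ _ _ ((C (atom_letter a) * U.+1 + #|letter sigma|) + (size cs * (B * U.+1)).+1).+1).
  rewrite [size (a :: cs)]/= mulSn; move: (leq_mul CB (leqnn U.+1)).
  move: (C _) #|_| (B * _) (size cs) => x y u z; nia.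
rewrite [map _ _]/= [flatten _]/= encode_atomE.
apply: (runs_While_step (s1 := conf (flatten [seq encode_atom a | a <- cs]) (base t.+1)
  (v ++ gadget_word (load (base t) 0 [seq val x | x <- atom_args a]) (gadget (atom_letter a))))).
- by rewrite head_is_layout.
- apply: runs_dispatch; have := H2 (flatten [seq encode_atom a | a <- cs]) v.
  by rewrite -map_comp; exact.
- by rewrite /= catA addnS -addSn; exact: IH2.
Qed.

Definition variable_loop : program :=
  While (head_is (pred1 (inr Exists))) (Seq advance (Seq (emit_gadget delta) (inc 1))).

Lemma runs_variable_loop : exists C, forall U k t, t + k <= U ->
  size (flatten [seq gadget_word (base x) delta | x <- iota t k]) <= k * (C * U.+1) /\
  forall v w, ~~ (if w is a :: _ then a == inr Exists else false) ->
    runs variable_loop (k * (C * U.+1)).+1 (conf (nseq k (inr Exists) ++ w) (base t) v)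
    (conf w (base (t + k)) (v ++ flatten [seq gadget_word (base x) delta | x <- iota t k])).
Proof.
have [C CP] := @runs_emit_gadget 0 delta (leq0n _).
exists (C + 3) => U; elim=> [|k IH] t tU.
  split=> // v w wE; rewrite addn0 cats0; apply: runs_While_end.
  by rewrite head_is_layout.
have [|IH1 IH2] := IH t.+1; first lia.
have [q||H1 H2] := CP U (base t); [|by []|].
  by rewrite /base; case: ifP => //; lia.
split=> [|v w wE].
  rewrite /= size_cat [X in _ <= X]mulSn; apply: leq_add IH1; apply: leq_trans H1 _; nia.
apply: (@runs_leq _ _ _ ((1 + (C * U.+1 + 1)) + (k * ((C + 3) * U.+1)).+1).+1); first nia.
apply: (runs_While_step (s1 := conf (nseq k (inr Exists) ++ w) (base t.+1)
  (v ++ gadget_word (base t) delta))).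
- by rewrite head_is_layout /= eqxx.
- apply: runs_Seq; first exact: runs_advance.
  apply: runs_Seq; first exact: H2.
  have := @runs_inc _ (letter tau) mk T 1 (nseq k (inr Exists) ++ w) (base t)
    (out_end _ (v ++ gadget_word (base t) delta)) isT.
  by rewrite (_ : upd (base t) 1 _ = base t.+1)//; apply: funext => q; rewrite /upd /base; case: eqP.
- by rewrite /= catA -[t + k.+1]addSnnS; exact: (IH2 _ _ wE).
Qed.

End ReductionProgram.

(** * Polynomial-time equivalence *)

Section ReductionMachine.
Variables (sigma tau : signature) (G : structure sigma) (D : structure tau).
Variable I : pp_interpretation G D.
Let K := dim I.
Let delta := domain_gadget I.
Let gadget := letter_gadget I.
Let mk : letter sigma := inr Stroke.
Let T := (max_arity sigma).+2.
Let L : finType := (letter sigma + letter tau)%type.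
Local Notation conf w c o := (@layout (letter sigma) (letter tau) mk T w c o).

Definition start_counters : program L T.+1 :=
  Act (fun rd => [tuple if 0 < i <= T then (Some (inl mk), Stay) else (tnth rd i, Stay) | i < T.+2]).

Lemma runs_start_counters w : runs start_counters 1
  (@input_tapes L T.+1 (letter sigma) inl w) (conf w (base 0) (out_end _ [::])).
Proof.
set s := @input_tapes _ _ _ _ _.
have := runs_Act (fun rd => [tuple if 0 < i <= T then (Some (inl mk : L), Stay)
  else (tnth rd i, Stay) | i < T.+2]) s.
congr (runs _ _ _ _); apply: funext => i.
rewrite /perform tnth_mktuple; case: ifPn => iT.
  rewrite layout_counter// /base (_ : (if _ then _ else _) = 0); last by case: ifP.
  rewrite /s /input_tapes /awrite /counter_tape /=.
  have -> : (i == ord0) = false by apply/eqP => i0; rewrite i0 in iT.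
  by congr pair; apply: funext => -[].
rewrite tnth_mktuple /awrite /= acons_abehead /s /input_tapes /layout.
case: eqVneq => [->|i0] //=.
have i0' : (i == 0 :> nat) = false by apply/negbTE; apply: contra i0 => /eqP i0; apply/eqP/val_inj.
rewrite i0' ifT; last by have := ltn_ord i; lia.
by rewrite /out_end /out_cells /=; congr pair; apply: funext => -[].
Qed.

(** The number of quantified variables is known only when all conjuncts have
    been read. So the quantifiers are written last, to the left of the
    conjuncts. *)
Definition write_quantifiers : program L T.+1 :=
  While (@pos (letter sigma) (letter tau) T 1)
    (Seq (@dec (letter sigma) (letter tau) T 1)
      (@seqs (letter sigma) (letter tau) T
        (nseq K (@put_left (letter sigma) (letter tau) T (inr Exists))))).

Lemma runs_write_quantifiers t v : runs write_quantifiers ((K + 3) * t).+1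
  (conf [::] (base t) (out_start _ v))
  (conf [::] (base 0) (out_start _ (nseq (t * K) (inr Exists) ++ v))).
Proof.
elim: t v => [|t IH] v; first by rewrite muln0; apply: runs_While_end; rewrite pos_layout.
apply: (@runs_leq _ _ _ ((1 + K.+1) + ((K + 3) * t).+1).+1); first lia.
rewrite mulSn [K + t * K]addnC nseqD -catA; apply: runs_While_step (IH _); first by rewrite pos_layout.
apply: runs_Seq.
  have := @runs_dec _ (letter tau) mk T 1 t [::] (base t.+1) (out_start _ v) isT erefl.
  by rewrite (_ : upd _ 1 t = base t); [exact|apply: funext => q; rewrite /upd /base; case: eqP].
elim: K v {IH} => [|k IHk] v; first exact: runs_skip.
have -> : nseq k.+1 (inr Exists : letter tau) ++ v = nseq k (inr Exists) ++ inr Exists :: v.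
  by rewrite -addn1 nseqD -catA.
by apply: (@runs_Seq _ _ _ _ 1 k.+1 _ _ _ _ (IHk _)); exact: runs_put_left.
Qed.

Definition reduction_program : program L T.+1 :=
  Seq start_counters
    (Seq (@variable_loop sigma tau K delta)
      (Seq (@conjunct_loop sigma tau K gadget)
        (Seq (@rewind (letter sigma) (letter tau) T)
          (Seq write_quantifiers
            (@on (letter sigma) (letter tau) T T.+1 (fun a => (a, MoveRight))))))).

Lemma gadget_word_place B r (c : nat -> nat) (cs : 'I_r.+1 -> 'I_B)
    (l : seq (atom tau (r.+1 * K))) :
  (forall i : 'I_r.+1, c (slot_counter i) = cs i) ->
  gadget_word K c l = flatten [seq encode_atom a | a <- [seq map_atom (place cs) a | a <- l]].
Proof.
move=> cE; have var (v : 'I_(r.+1 * K)) : var_word tau K c v = encode_var tau (place cs v).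
  by rewrite /var_word /output_name /encode_var /= -cE.
rewrite /gadget_word -map_comp; congr flatten; apply: eq_map => a /=.
rewrite encode_atomE /atom_word; case: a => [|x y|R t] //=; first by rewrite !var.
rewrite -map_comp; congr (_ :: flatten _); exact: eq_map.
Qed.

Lemma flatten_map_flatten (X Y : Type) (f : X -> seq Y) (ss : seq (seq X)) :
  flatten [seq f x | x <- flatten ss] = flatten [seq flatten [seq f x | x <- s] | s <- ss].
Proof. by elim: ss => //= s ss IH; rewrite map_cat flatten_cat IH. Qed.

Lemma conjunct_wordsE n (cs : seq (atom sigma n)) t :
  conjunct_words gadget t cs = flatten [seq gadget_word K
    (load (base (t + j)) 0 [seq val x | x <- atom_args (tnth (in_tuple cs) j)])
    (gadget (atom_letter (tnth (in_tuple cs) j))) | j : 'I_(size cs) <- enum 'I_(size cs)].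
Proof.
elim: cs t => [|a cs IH] t; first by rewrite enum_ord0.
rewrite /= enum_ordSl /= addn0 IH -map_comp; congr cat; congr flatten.
apply: eq_map => j /=; rewrite addSnnS.
by have -> : tnth (in_tuple (a :: cs)) (lift ord0 j) = tnth (in_tuple cs) j by rewrite !(tnth_nth a).
Qed.

Lemma encode_reduce (s : pp_sentence sigma) :
  encode_sentence (reduce I s) =
  nseq ((nvars s + size (conjuncts s)) * K) (inr Exists) ++
  flatten [seq gadget_word K (base x) delta | x <- iota 0 (nvars s)] ++
  conjunct_words gadget (nvars s) (conjuncts s).
Proof.
rewrite /encode_sentence /=; congr cat; rewrite map_cat flatten_cat !flatten_map_flatten.
congr cat.
  rewrite -val_enum_ord -!map_comp; congr flatten; apply: eq_map => x /=.
  rewrite (gadget_word_place (cs := fun=> lshift (size (conjuncts s)) x))// => i.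
  by rewrite ord1.
rewrite conjunct_wordsE -map_comp; congr flatten; apply: eq_map => j /=.
apply/esym/gadget_word_place => i; rewrite /atom_slots.
case: unliftP => [k ->|->] //=.
rewrite add0n /load size_map size_tuple ifT; last by rewrite add0n leq_addl addnC ltn_add2l ltn_ord.
set args := atom_args _; rewrite add0n addnK (nth_map (tnth args k)) ?size_tuple//.
by rewrite -tnth_nth.
Qed.

(** The numbers of variables and of conjuncts and all counter values are at most
    the length of the input, and each conjunct takes linear time. *)
Lemma runs_reduction_program : exists C, forall s : pp_sentence sigma, exists ts,
  runs reduction_program (C * (size (encode_sentence s) ^ 2) + C)
    (@input_tapes L T.+1 (letter sigma) inl (encode_sentence s)) ts /\
  (ts ord_max).2 = nth None [seq Some (inr b) | b <- encode_sentence (reduce I s)].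
Proof.
have [C1 CP1] := runs_variable_loop sigma delta; have [C2 CP2] := runs_conjunct_loop gadget.
exists (6 * (C1 + C2 + K + 10)) => s; set U := size (encode_sentence s).
set n := nvars s; set m := size (conjuncts s).
have nmU : n + m <= U.
  rewrite /U /encode_sentence size_cat size_nseq leq_add2l /m.
  elim: (conjuncts s) => //= a cs IH; rewrite size_cat encode_atomE /=.
  by rewrite addSn ltnS; apply: leq_trans IH _; rewrite leq_addl.
have [|S1 R1] := CP1 U n 0; first by rewrite add0n; lia.
have [||S2 R2] := CP2 U n (conjuncts s) n; [lia|exact: nmU|].
pose w1 := flatten [seq gadget_word K (base x) delta | x <- iota 0 n].
pose w2 := conjunct_words gadget n (conjuncts s).
pose ts0 := conf [::] (base 0) (out_start _ (encode_sentence (reduce I s))).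
pose ts (i : 'I_T.+2) := if i == T.+1 :> nat then awrite (ts0 i) ((ts0 i).2 0, MoveRight) else ts0 i.
exists ts; split; last first.
  by rewrite /ts /= eqxx /awrite /ts0 /layout /= eqxx /out_start.
apply: (@runs_leq _ _ _ (1 + ((n * (C1 * U.+1)).+1 + ((m * (C2 * U.+1)).+1 +
  ((2 * size (w1 ++ w2)).+2 + (((K + 3) * (n + m)).+1 + 1)))))).
  rewrite size_cat -/w1 -/w2 in S1 S2 *.
  have H1 : n * (C1 * U.+1) <= C1 * (U * U.+1) by nia.
  have H2 : m * (C2 * U.+1) <= C2 * (U * U.+1) by nia.
  have H3 : (K + 3) * (n + m) <= (K + 3) * U by nia.
  rewrite -mulnn; move: H1 H2 H3 S1 S2.
  rewrite -/w1 -/w2 -/m.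
  by move: (size w1) (size w2) (n * _) (m * _) ((K + 3) * (n + m)) => a b c d e; nia.
apply: runs_Seq; first exact: runs_start_counters.
apply: runs_Seq; first apply: R1.
  by case: (conjuncts s) => //= a cs; rewrite encode_atomE /=; case: a => // *; apply/eqP.
apply: runs_Seq; first exact: R2.
apply: runs_Seq; first exact: runs_rewind.
apply: runs_Seq; first exact: runs_write_quantifiers.
rewrite -[_ ++ _ ++ _]encode_reduce; exact: runs_on.
Qed.

Lemma reduce_polytime : @polytime_computable (CSP G) (CSP D) (reduce I).
Proof.
have [C CP] := runs_reduction_program.
exists (@program_machine L T.+1 (letter sigma) (letter tau) inl inr
  (fun _ _ E => let: erefl := E in erefl) (fun _ _ E => let: erefl := E in erefl)
  reduction_program), C, 2 => s.
have [ts [run out]] := CP s.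
exact: program_computes run out.
Qed.

End ReductionMachine.

Lemma topological_iso_reducible (sigma tau : signature)
    (G : structure sigma) (D : structure tau) :
  oligomorphic G -> oligomorphic D -> topological_clone_isomorphic (Pol D) (Pol G) ->
  polytime_reducible (CSP G) (CSP D).
Proof.
move=> oG oD [xi [xi' [_ xi'K [hxi _] cxi _]]].
have [I] := pp_interpretation_exists hxi (fun k g => ex_intro _ (xi' k g) (xi'K k g)) cxi oG oD.
exists (reduce I); first exact: reduce_polytime.
exact: reduceP.
Qed.

Lemma topological_clone_isomorphic_sym (D E : choiceType) (C : clone D) (C' : clone E) :
  topological_clone_isomorphic C C' -> topological_clone_isomorphic C' C.
Proof. by move=> [xi [xi' [K K' [h h'] c c']]]; exists xi', xi; split. Qed.

Theorem corollary2 (sigma tau : signature)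
    (Gamma : structure sigma) (Delta : structure tau)
    (hGamma : finite_set [set: Gamma] \/ omega_categorical Gamma)
    (hDelta : finite_set [set: Delta] \/ omega_categorical Delta)
    (hiso : topological_clone_isomorphic (Pol Gamma) (Pol Delta)) :
  polytime_equivalent (CSP Gamma) (CSP Delta).
Proof.
have olig rho (A : structure rho) : finite_set [set: A] \/ omega_categorical A -> oligomorphic A.
  by case; [exact: finite_oligomorphic|exact: omega_categorical_oligomorphic].
have oG := olig _ _ hGamma; have oD := olig _ _ hDelta; split.
  exact/(topological_iso_reducible oG oD)/topological_clone_isomorphic_sym.
exact: topological_iso_reducible.
Qed.
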